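(* Any basis for the class of uncountable regular Hausdorff topological spaces has cardinality strictly greater than $\aleph_1$.
   Context: The ambient theory is ZFC. A family $\mathcal{B}$ of uncountable regular Hausdorff spaces is a basis for the class of uncountable regular Hausdorff spaces if for every uncountable regular Hausdorff space $C$ there is $B\in\mathcal{B}$ such that $B$ is homeomorphic to a subspace of $C$. *)

(* Defs.v *)
From HB Require Import structures.
From mathcomp Require Import all_boot.
From mathcomp Require Import all_classical wochoice.
From mathcomp Require Import topology.

Set Implicit Arguments.
Unset Strict Implicit.
Unset Printing Implicit Defensive.

Local Open Scope classical_set_scope.
Local Open Scope card_scope.

Definition card_lt (T U : Type) (A : set T) (B : set U) : Prop :=
  A #<= B /\ ~ (B #<= A).

(* A pair (D, R) is a well-ordered subset of nat when R, restricted to D, is a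
   (reflexive) well-order; the values of R outside D are irrelevant. *)
Definition nat_wo : set ({pred nat} * rel nat) :=
  [set w | wo_chain w.2 w.1].

Definition wo_iso (v w : {pred nat} * rel nat) : Prop :=
  exists2 f : nat -> nat, set_bij [set` v.1] [set` w.1] f &
    {in v.1 &, forall x y, w.2 (f x) (f y) = v.2 x y}.

Definition order_type (w : {pred nat} * rel nat) : set ({pred nat} * rel nat) :=
  [set v | nat_wo v /\ wo_iso w v].

(* The countable ordinals are exactly the order types of well-ordered subsets
   of nat (Hartogs), so this set is a copy of omega_1: its cardinality is
   aleph_1. *)
Definition aleph1 : set (set ({pred nat} * rel nat)) := order_type @` nat_wo.

Definition homeomorphic (X Y : topologicalType) : Prop :=
  exists (f : X -> Y) (g : Y -> X),
    [/\ cancel f g, cancel g f, continuous f & continuous g].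

(* set_type A carries the subspace topology. *)
Definition embeds_in (X Y : topologicalType) : Prop :=
  exists A : set Y, homeomorphic X (set_type A).

Definition unctbl_regular_hausdorff (X : topologicalType) : Prop :=
  [/\ ~ countable [set: X], @regular_space X & hausdorff_space X].

Definition is_basis (I : Type) (B : I -> topologicalType) : Prop :=
  (forall i, unctbl_regular_hausdorff (B i)) /\
  (forall C : topologicalType, unctbl_regular_hausdorff C ->
     exists i, embeds_in (B i) C).

(* Main.v *)
From HB Require Import structures.
Require Import Defs.
From mathcomp Require Import all_boot all_order all_classical wochoice topology.
From mathcomp Require Import zify.

(** There are more than aleph_1 uncountable regular Hausdorff spaces no two of
which share an uncountable subspace up to homeomorphism.  A basis must contain a
different member for each of them, so it cannot have size at most aleph_1.

The spaces are variants of Moore's L space.  Fix on omega_1 a ladder system,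
that is, a cofinal sequence of length at most omega in every countable ordinal.
Walking from b down to a along the ladders yields a number weight b a (finite-to-one
in a, and coherent: weight a and weight b differ at finitely many points below a)
and a finite set trace a b of ordinals below a.  The oscillation osc a b counts
how often, along trace a b, weight a passes from being at most weight b to
exceeding it.  The theorem oscillation is the heart of the matter: given two
unbounded families of finite sets of ordinals and a number n, there are a in the
first and b_0, ..., b_n in the second, all above a, such that replacing b_0 by
b_m raises every oscillation number between an element of a and the
corresponding element of b_0 by exactly m.

To exploit the shift by m, attach to every pair of ordinals (a, c) a real, and to
every real x a sequence wave x of bits.  Waves of distinct reals are independent
under shifts, uniformly (waves_independent): for finitely many distinct reals
there is n such that, whatever the offsets t_i and target bits e_i, some m <= n
satisfies wave x_i (t_i + m) = e_i for all i.  For G : omega_1 -> omega_1 the space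
moore_space G consists of the points moore_point G b of the cube 2^omega_1, whose
coordinate at a < b is wave (a, G a) (osc a b).

Suppose that G and G' are eventually different and that an uncountable space P
embeds into both moore_space G and moore_space G', sending p to the points of
index u p and v p.  Coordinate v p of the second image is true at p, hence on a
neighbourhood of p, and this neighbourhood contains all q whose first image agrees
with that of p at finitely many coordinates F p.  After thinning out P, the
oscillation theorem applied to the sets F p together with v p and to the pairs
{u q, v q} provides p and q_0, ..., q_n, and independence selects an m for which
q_m has the coordinates of p on F p and the coordinate false at v p.  This is a
contradiction (no_common_subspace).

Finally, a maximal family of pairwise eventually different functions G on omega_1
has more than aleph_1 members, by diagonalization (many_eventually_different), where
aleph_1, defined through order types of subsets of nat, is at most the size of
omega_1 (aleph1_le_omega1). *)

Set Implicit Arguments.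
Unset Strict Implicit.
Unset Printing Implicit Defensive.

(** * Bit sequences independent under shifts *)

(** Every factor base N is 1 modulo twice the product of the earlier ones, hence odd and
coprime to them.  The power makes it exceed any product of N earlier factors,
repetitions allowed, which bounds the windows considered below. *)
Fixpoint base_prod (N : nat) : nat :=
  if N is N'.+1 then base_prod N' * (2 * N'.+1 * base_prod N' ^ N'.+1).+1 else 1.

Definition base (N : nat) : nat := (2 * N.+1 * base_prod N ^ N.+1).+1.

Lemma base_prodS N : base_prod N.+1 = base_prod N * base N.
Proof. by []. Qed.

Lemma base_prod_gt0 N : 0 < base_prod N.
Proof. by elim: N => // N IH; rewrite base_prodS muln_gt0 IH. Qed.

Lemma base_prod_dvd M N : M <= N -> base_prod M %| base_prod N.
Proof.
move=> /subnK <-; elim: (N - M) => [|n IH] //.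
by rewrite addSn base_prodS; apply: dvdn_trans IH _; apply: dvdn_mulr.
Qed.

Lemma base_dvd_prod M N : M < N -> base M %| base_prod N.
Proof. by move=> /base_prod_dvd; apply: dvdn_trans; rewrite base_prodS dvdn_mull. Qed.

Lemma base_prod_leq M N : M <= N -> base_prod M <= base_prod N.
Proof. by move=> MN; apply: dvdn_leq; [exact: base_prod_gt0|exact: base_prod_dvd]. Qed.

Lemma odd_base N : odd (base N).
Proof. by rewrite /base /= -mulnA oddM. Qed.

Lemma base_gt2 N : 2 < base N.
Proof.
rewrite /base ltnS -mulnA leq_pmulr // muln_gt0 /= expn_gt0 base_prod_gt0 //.
Qed.

Lemma coprime_prod_base N : coprime (base_prod N) (base N).
Proof.
by rewrite /base expnSr mulnA -addn1 /coprime gcdnMDl gcdn1.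
Qed.

Lemma coprime_base M N : M < N -> coprime (base M) (base N).
Proof. by move=> /base_dvd_prod/coprime_dvdl; apply; apply: coprime_prod_base. Qed.

(** The first j bits of x in binary, after a leading 1: codes of longer prefixes
exceed codes of shorter ones. *)
Fixpoint prefix_code (x : nat -> bool) (j : nat) : nat :=
  if j is j'.+1 then (prefix_code x j').*2 + x j' else 1.

Lemma prefix_code_ge x j : 2 ^ j <= prefix_code x j.
Proof. by elim: j => //= j IH; rewrite expnS mul2n; lia. Qed.

Lemma prefix_code_lt x j : prefix_code x j < 2 ^ j.+1.
Proof. by elim: j => //= j IH; rewrite expnS mul2n; case: (x j); lia. Qed.

Lemma prefix_code_inj x y j i : prefix_code x j = prefix_code y j -> i < j -> x i = y i.
Proof.
elim: j => //= j IH E; have [xy cxy] : x j = y j /\ prefix_code x j = prefix_code y j.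
  by case: (x j) (y j) E => -[] /=; lia.
by rewrite ltnS leq_eqVlt => /orP[/eqP -> //|]; apply: IH.
Qed.

(** Place values of a mixed-radix numeration attached to x.  The j-th base is
determined by the first j bits of x, so distinct reals share finitely many bases
and have coprime ones from then on. *)
Fixpoint radix (x : nat -> bool) (j : nat) : nat :=
  if j is j'.+1 then radix x j' * base (prefix_code x j') else 1.

Lemma radix_dvd_prod x j : radix x j %| base_prod (2 ^ j).
Proof.
elim: j => //= j IH; apply: dvdn_trans (base_prod_dvd (prefix_code_lt x j)).
rewrite base_prodS; apply: dvdn_mul => //; apply: dvdn_trans IH _.
exact: base_prod_dvd (prefix_code_ge x j).
Qed.

Lemma radix_dvd x i j : i <= j -> radix x i %| radix x j.
Proof.
move=> /subnK <-; elim: (j - i) => [|n IH] //=.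
by apply: dvdn_trans IH _; apply: dvdn_mulr.
Qed.

Lemma radix_gt x j : j < radix x j.
Proof.
elim: j => //= j IH; have := base_gt2 (prefix_code x j); nia.
Qed.

Definition carry_sum (x : nat -> bool) (J t : nat) : nat := \sum_(j < J) t %/ radix x j.+1.

(** A discrete analogue of the parity of floor(t * theta) with
theta = 1 / radix x 1 + 1 / radix x 2 + ..., a Liouville number determined by x.
The terms of index t and above vanish. *)
Definition wave (x : nat -> bool) (t : nat) : bool := odd (carry_sum x t t).

Lemma waveE x t J : t <= J -> wave x t = odd (carry_sum x J t).
Proof.
rewrite /wave => /subnK <-; elim: (J - t) => [|n ->] //.
rewrite /carry_sum addSn [in RHS]big_ord_recr /= divn_small ?addn0 //.
have := radix_gt x (n + t).+1; rewrite /=; lia.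
Qed.

Lemma chinese_seq (k : nat) (p r : nat -> nat) :
  (forall i, i < k -> 0 < p i) -> (forall i j, i < j -> j < k -> coprime (p i) (p j)) ->
  exists2 m, m < \prod_(i < k) p i & forall i, i < k -> m = r i %[mod p i].
Proof.
elim: k => [|k IH] p0 cop; first by exists 0; rewrite ?big_ord0.
have [|i j ij jk|m _ mP] := IH; first by move=> i ik; apply: p0; lia.
  by apply: cop => //; lia.
have copk : coprime (\prod_(i < k) p i) (p k).
  apply: (big_ind (fun n => coprime n (p k))); first exact: coprime1n.
    by move=> a b ca cb; rewrite coprimeMl ca.
  by move=> i _; apply: cop.
have P0 : 0 < \prod_(i < k.+1) p i by apply: prodn_gt0 => i; apply: p0.
exists (chinese (\prod_(i < k) p i) (p k) m (r k) %% \prod_(i < k.+1) p i).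
  by rewrite ltn_mod.
move=> i; rewrite ltnS leq_eqVlt => /orP[/eqP ->|ik].
  by rewrite modn_dvdm ?chinese_modr // big_ord_recr /= dvdn_mull.
have piP : p i %| \prod_(i < k) p i by rewrite (bigD1 (Ordinal ik)) //= dvdn_mulr.
rewrite modn_dvdm; last by rewrite big_ord_recr /= dvdn_mulr.
rewrite -(mP i ik) -(modn_dvdm (chinese _ _ _ _) piP) chinese_modl //.
exact: modn_dvdm.
Qed.

(** Since 2 * g is even and coprime to p, the numbers U + 2 * g * m keep the parity of
U and reach all residues modulo p, hence all residues of that parity modulo 2 * p.
As p is odd, both halves of the interval from 0 to 2 * p contain such a residue. *)
Lemma half_turn (p U g : nat) (e : bool) : odd p -> 2 < p -> coprime g p ->
  exists r, forall m, m = r %[mod p] -> odd ((U + 2 * g * m) %/ p) = e.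
Proof.
move=> op p2 cgp; have c2p : coprime 2 p by rewrite coprime2n.
have c2gp : coprime (2 * g) p by rewrite coprimeMl c2p.
(* the residue modulo 2 * p with the parity of U in the half prescribed by e *)
pose v := if e then p + ~~ odd U else nat_of_bool (odd U).
have vlt : v < 2 * p by rewrite /v; case: (e); case: (odd U) => /=; lia.
have ov : odd v = odd U by rewrite /v; case: (e); rewrite ?oddD ?op; case: (odd U).
pose w := v + p * U - U; have wE : U + w = v + p * U by rewrite /w; nia.
pose c := chinese (2 * g) p 0 w.
have dc : 2 * g %| c by rewrite /dvdn chinese_modl // mod0n.
exists (c %/ (2 * g)) => m mr.
have E : U + 2 * g * m = v %[mod 2 * p].
  apply/eqP; rewrite chinese_remainder //; apply/andP; split.
    by rewrite !modn2 oddD -mulnA oddM /= addbF ov.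
  rewrite -modnDmr -modnMmr mr modnMmr [2 * g * _]mulnC divnK //.
  by rewrite chinese_modr // modnDmr wE [p * U]mulnC addnC modnMDl.
have -> : U + 2 * g * m = (U + 2 * g * m) %/ (2 * p) * 2 * p + v.
  by rewrite {1}(divn_eq (U + 2 * g * m) (2 * p)) E (modn_small vlt) mulnA.
rewrite divnMDl ?oddD ?muln2 ?odd_double /=; last exact: ltn_trans p2.
have bp (c0 : bool) : c0 < p by apply: leq_ltn_trans (leq_b1 _) (ltn_trans _ p2).
rewrite /v; case: (e); last by rewrite divn_small.
by rewrite -{1}[p]mul1n divnMDl ?divn_small //; exact: ltn_trans p2.
Qed.

Lemma odd_sum_eq (n : nat) (f g : nat -> nat) : (forall j, j < n -> odd (f j) = odd (g j)) ->
  odd (\sum_(j < n) f j) = odd (\sum_(j < n) g j).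
Proof.
elim: n => [|n IH] H; first by rewrite !big_ord0.
by rewrite !big_ord_recr /= !oddD H // IH // => j jn; apply: H; lia.
Qed.

Lemma separating_level (k : nat) (x : nat -> nat -> bool) :
  (forall i j, i < j -> j < k -> x i <> x j) ->
  exists2 l, k <= l & forall i j, i < j -> j < k -> prefix_code (x i) l <> prefix_code (x j) l.
Proof.
move=> xd; have /choice[pos posP] : forall ij : nat * nat, exists n,
    ij.1 < ij.2 -> ij.2 < k -> x ij.1 n <> x ij.2 n.
  move=> [i j] /=; apply: contrapT => nn; have [ij jk] : i < j /\ j < k.
    by split; apply: contrapT => ?; apply: nn; exists 0.
  apply: (xd i j ij jk); apply/funext => n; apply: contrapT => xn.
  by apply: nn; exists n.
exists (k + \sum_(i < k) \sum_(j < k) (pos (val i, val j)).+1); first exact: leq_addr.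
move=> i j ij jk /prefix_code_inj E; apply: (posP (i, j)) => //=; apply: E.
have ik : i < k by lia.
rewrite (bigD1 (Ordinal ik)) //= (bigD1 (Ordinal jk)) //=; lia.
Qed.

(** Over a window of length at most Q i the quotient by Q i increases at most once.
With k quotients and k.+1 consecutive blocks of length n, some block is free of
increases. *)
Lemma quiet_block (k n : nat) (Q t : nat -> nat) : 0 < n ->
  (forall i, i < k -> k.+1 * n <= Q i) ->
  exists2 r, r <= k & forall i s, i < k -> s < n ->
    (t i + r * n + s) %/ Q i = (t i + r * n) %/ Q i.
Proof.
move=> n0 Qn; apply: contrapT => nr.
have /choice[f fP] : forall r : 'I_k.+1, exists i : 'I_k, exists2 s, s < n &
    (t i + r * n + s) %/ Q i <> (t i + r * n) %/ Q i.
  move=> r; apply: contrapT => ni; apply: nr; exists r; first by rewrite -ltnS.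
  move=> i s ik sn; apply: contrapT => Ns; apply: ni; exists (Ordinal ik).
  by exists s.
have finj : injective f.
  suff aux (r r' : 'I_k.+1) : r < r' -> f r <> f r'.
    move=> r r' frr'; apply/val_inj; have [/aux|/aux|//] := ltngtP r r'.
      by rewrite frr'.
    by rewrite frr'.
  move=> rr' E; have [s sn Es] := fP r; have [s' s'n Es'] := fP r'.
  move: Es Es'; rewrite -E; set i := f r; set q := Q i.
  have qn : k.+1 * n <= q by apply: Qn.
  have q0 : 0 < q by apply: leq_trans qn; rewrite muln_gt0.
  have r'k := ltn_ord r'.
  have e1 : (r.+1 * n <= r' * n) by rewrite leq_mul2r rr' orbT.
  have e2 : (r'.+1 * n <= k.+1 * n) by rewrite leq_mul2r r'k orbT.
  have le1 : t i + r * n + s <= t i + r' * n by rewrite mulSn in e1; lia.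
  have le2 : t i + r' * n + s' < t i + r * n + q by rewrite mulSn in e2; lia.
  move=> /eqP d1 /eqP d2.
  have {}d1 : (t i + r * n) %/ q < (t i + r * n + s) %/ q.
    by rewrite ltn_neqAle eq_sym d1 leq_div2r // leq_addr.
  have {}d2 : (t i + r' * n) %/ q < (t i + r' * n + s') %/ q.
    by rewrite ltn_neqAle eq_sym d2 leq_div2r // leq_addr.
  have d3 := leq_div2r q le1.
  have d4 : ((t i + r * n) %/ q).+2 <= (t i + r' * n + s') %/ q.
    exact: leq_ltn_trans (leq_trans d1 d3) d2.
  have := leq_trans d4 (leq_div2r q (ltnW le2)).
  by rewrite -{2}[q]mul1n divnDMl // addn1 ltnn.
by have := max_card [set f x | x in 'I_k.+1]%SET; rewrite card_imset // !card_ord ltnn.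
Qed.

(** Choose a level l at which the k prefixes have distinct codes.  The terms of index
above l of the k sums are constant on a common block by quiet_block.  Inside this
block restrict to multiples of a number G divisible by twice the place values up to
l: the parities of the terms of index below l then do not move either, and the
terms of index l are controlled independently by the Chinese remainder theorem,
their bases being distinct. *)
Theorem waves_independent (k : nat) (x : nat -> nat -> bool) :
  (forall i j, i < j -> j < k -> x i <> x j) ->
  exists n, forall (t : nat -> nat) (e : nat -> bool),
    exists2 m, m <= n & forall i, i < k -> wave (x i) (t i + m) = e i.
Proof.
move=> /separating_level[l kl sep].
(* G is even and divisible by twice every place value up to level l, and it is prime
   to all bases p i; the multiples of G below n = G * M represent all residues. *)
pose p i := base (prefix_code (x i) l); pose G := 2 * base_prod (2 ^ l).
pose M := \prod_(i < k) p i; pose n := G * M.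
have p0 i : 0 < p i by [].
have M0 : 0 < M by apply: prodn_gt0 => i; apply: p0.
have G0 : 0 < G by rewrite muln_gt0 base_prod_gt0.
have n0 : 0 < n by rewrite muln_gt0 G0.
have cop i j : i < j -> j < k -> coprime (p i) (p j).
  move=> ij jk; rewrite /p; have := sep i j ij jk.
  have [/coprime_base//|/coprime_base|//] := ltngtP (prefix_code (x i) l) (prefix_code (x j) l).
  by rewrite coprime_sym.
have Qn i : i < k -> k.+1 * n <= radix (x i) l.+2.
  move=> ik; set c := prefix_code (x i) l.+1; have cl : 2 ^ l.+1 <= c := prefix_code_ge _ _.
  have ll := ltn_expl l.+1 (isT : 1 < 2).
  have pb j : p j <= base_prod c.
    apply: dvdn_leq; first exact: base_prod_gt0.
    by apply: base_dvd_prod; apply: leq_trans (prefix_code_lt _ _) cl.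
  have MB : M <= base_prod c ^ k.
    apply: leq_trans (_ : \prod_(i < k) base_prod c <= _); first exact: leq_prod.
    by rewrite prod_nat_const card_ord.
  have GB : base_prod (2 ^ l) <= base_prod c.
    by apply: base_prod_leq; apply: leq_trans cl; rewrite leq_exp2l.
  apply: leq_trans (_ : base c <= _); last first.
    by rewrite /= leq_pmull // -/(radix _ l.+1) (leq_ltn_trans _ (radix_gt _ _)).
  apply: leq_trans (leqnSn _); rewrite /n /G.
  apply: leq_trans (_ : c.+1 * (2 * base_prod c * base_prod c ^ k) <= _).
    by rewrite leq_mul ?leq_mul //; lia.
  rewrite -mulnA -expnS mulnA [c.+1 * 2]mulnC leq_mul2l leq_pexp2l ?base_prod_gt0 ?orbT //; lia.
exists (k.+1 * n) => t e.
have [r rk rP] := quiet_block t n0 Qn.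
pose T i := t i + r * n.
have [Qd gE] : (forall i, radix (x i) l %| base_prod (2 ^ l)) /\
   forall i, G = 2 * (base_prod (2 ^ l) %/ radix (x i) l) * radix (x i) l.
  have H i := radix_dvd_prod (x i) l; split => // i; by rewrite -mulnA divnK.
pose g i := base_prod (2 ^ l) %/ radix (x i) l.
(* the parity contributed by the terms of index different from l, constant on the block *)
pose rest i := odd (\sum_(j < l) T i %/ radix (x i) j.+1) (+) 
   odd (\sum_(j < (t i + k.+1 * n)) T i %/ radix (x i) (l.+1 + j).+1).
have /choice[res resP] : forall i, exists s, forall m, m = s %[mod p i] ->
    odd ((T i %/ radix (x i) l + 2 * g i * m) %/ p i) = e i (+) rest i.
  move=> i; apply: half_turn; [exact: odd_base|exact: base_gt2|].
  apply: coprime_dvdl (dvdn_div (Qd i)) _.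
  exact: coprime_dvdl (base_prod_dvd (prefix_code_ge _ _)) (coprime_prod_base _).
have [m mM mP] := @chinese_seq k p res (fun i _ => p0 i) cop.
have sn : G * m < n by rewrite ltn_pmul2l.
exists (r * n + G * m); first by rewrite mulSn; nia.
move=> i ik; rewrite addnA -/(T i).
rewrite (@waveE _ _ (l.+1 + (t i + k.+1 * n))); last by rewrite /T mulSn; nia.
rewrite /carry_sum big_split_ord big_ord_recr /= !oddD.
have -> : odd (\sum_(j < l) (T i + G * m) %/ (radix (x i) j.+1)) =
          odd (\sum_(j < l) T i %/ (radix (x i) j.+1)).
  apply: (odd_sum_eq (f := fun j => (T i + G * m) %/ radix (x i) j.+1)
                     (g := fun j => T i %/ radix (x i) j.+1)) => j jl.
  have /dvdnP[q Eq] : radix (x i) j.+1 %| base_prod (2 ^ l).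
    by apply: dvdn_trans (Qd i); apply: radix_dvd.
  have -> : T i + G * m = 2 * q * m * radix (x i) j.+1 + T i.
    by rewrite /G Eq addnC; congr addn; nia.
  by rewrite divnMDl ?oddD -?mulnA ?oddM //; apply: leq_ltn_trans (radix_gt _ _).
have -> : odd ((T i + G * m) %/ (radix (x i) l * base (prefix_code (x i) l))) = e i (+) rest i.
  rewrite divnMA -(resP i m (mP i ik)) -/(p i) /g; congr (odd (_ %/ _)).
  rewrite {1}(gE i) mulnAC addnC divnMDl; last exact: leq_ltn_trans (radix_gt _ _).
  by rewrite addnC.
have -> : odd (\sum_(j < t i + k.+1 * n) (T i + G * m) %/ radix (x i) (l.+1 + j).+1) =
          odd (\sum_(j < t i + k.+1 * n) T i %/ radix (x i) (l.+1 + j).+1).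
  apply: (odd_sum_eq (f := fun j => (T i + G * m) %/ radix (x i) (l.+1 + j).+1)
                     (g := fun j => T i %/ radix (x i) (l.+1 + j).+1)) => j _.
  have /dvdnP[q ->] : radix (x i) l.+2 %| radix (x i) (l.+1 + j).+1.
    by apply: radix_dvd; rewrite ltnS leq_addr.
  by rewrite [q * _]mulnC !(divnMA _ (radix (x i) l.+2)) /T rP.
rewrite /rest; set a := odd (\sum_(j < l) _); set b := odd (\sum_(j < _ + _) _).
by case: a; case: b; case: (e i).
Qed.

Import Order.TTheory.
Local Open Scope order_scope.
Local Open Scope card_scope.
Local Open Scope classical_set_scope.

(** * The first uncountable ordinal *)

Definition cantor_wo : rel (nat -> bool) :=
  sval (well_ordering_principle (nat -> bool)).

Lemma cantor_woP : well_order cantor_wo.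
Proof. exact: (svalP (well_ordering_principle (nat -> bool))). Qed.

Lemma well_order_total (T : eqType) (R : rel T) : well_order R -> total R.
Proof. by move=> Rwo x y; apply: (@wo_chainW _ R predT) => // A _; apply: Rwo. Qed.

Lemma well_order_anti (T : eqType) (R : rel T) : well_order R -> antisymmetric R.
Proof.
move=> Rwo x y; apply: (@wo_chain_antisymmetric _ R predT) => // A _.
exact: Rwo.
Qed.

Lemma well_order_trans (T : eqType) (R : rel T) : well_order R -> transitive R.
Proof.
move=> Rwo y x z Rxy Ryz.
have [|m [[Am mP] _]] := Rwo [pred t | t \in [:: x; y; z]].
  by exists x; rewrite !inE eqxx.
have /mP mx : x \in [pred t | t \in [:: x; y; z]] by rewrite !inE eqxx.
have /mP my : y \in [pred t | t \in [:: x; y; z]] by rewrite !inE eqxx orbT.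
have /mP mz : z \in [pred t | t \in [:: x; y; z]] by rewrite !inE eqxx !orbT.
move: Am; rewrite !inE => /or3P[] /eqP E; subst m => //.
  have -> // : x = y by apply: (well_order_anti Rwo); rewrite Rxy mx.
have -> // : z = y by apply: (well_order_anti Rwo); rewrite Ryz my.
Qed.

Lemma well_order_min (T : eqType) (R : rel T) (A : set T) :
  well_order R -> A !=set0 -> exists2 m, A m & forall x, A x -> R m x.
Proof.
move=> Rwo [a Aa]; have [|m [[Am mP] _]] := Rwo [pred x | `[< A x >]].
  by exists a; apply/asboolP.
exists m; first exact/asboolP.
by move=> x Ax; apply: mP; apply/asboolP.
Qed.

Lemma well_order_ind (T : eqType) (R : rel T) : well_order R ->
  well_founded (fun x y => R x y && (x != y)).
Proof.
move=> Rwo x; apply: contrapT => nx.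
have [|m nm mmin] := @well_order_min _ R [set x | ~ Acc (fun x y => R x y && (x != y)) x] Rwo.
  by exists x.
apply: nm; constructor => y /andP[Rym /eqP yNm]; apply: contrapT => ny.
by apply: yNm; apply: (well_order_anti Rwo); rewrite Rym mmin.
Qed.

Lemma uncountable_cantor : ~ countable [set: nat -> bool].
Proof.
move=> /countable_injP[f finj].
pose d n := `[< exists x, f x = n /\ ~~ x n >].
have fdd x : f x = f d -> x = d by apply: finj; rewrite in_setT.
have [dt|df] := boolP (d (f d)).
  by move: (dt) => /asboolP[x [/fdd ->]]; rewrite dt.
by move: (df) => /asboolPn; apply; exists d.
Qed.

(** The points with countably many predecessors form an uncountable initial segment of
the well-ordered set 2^nat.  Realized in this way, every countable ordinal is also
a real. *)
Definition omega1 : Type :=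
  {x : nat -> bool | countable [set y | cantor_wo y x && (y != x)]}.

HB.instance Definition _ := gen_eqMixin omega1.
HB.instance Definition _ := gen_choiceMixin omega1.

Definition om_le (x y : omega1) := cantor_wo (sval x) (sval y).

Lemma om_le_anti : antisymmetric om_le.
Proof. by move=> x y /(well_order_anti cantor_woP) /eq_sig_hprop; apply. Qed.

Lemma om_le_trans : transitive om_le.
Proof. by move=> y x z; apply: (well_order_trans cantor_woP). Qed.

Lemma om_le_total : total om_le.
Proof. by move=> x y; apply: (well_order_total cantor_woP). Qed.

Fact om_display : Order.disp_t. Proof. exact: Order.Disp tt tt. Qed.

HB.instance Definition _ := Order.isOrder.Build om_display omega1
  (fun _ _ => erefl) (fun _ _ => erefl) (fun _ _ => erefl)
  om_le_anti om_le_trans om_le_total.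

Local Notation W := omega1.

Lemma om_min_ex (A : set W) : A !=set0 -> exists2 m, A m & forall x, A x -> m <= x.
Proof.
move=> [a Aa]; have [|_ [m Am <-] mmin] := @well_order_min _ _ [set sval x | x in A] cantor_woP.
  by exists (sval a), a.
by exists m => // x Ax; apply: mmin; exists x.
Qed.

Lemma om_wf : well_founded (fun x y : W => x < y).
Proof.
move=> x; apply: contrapT => nx.
have [|m nm mmin] := @om_min_ex [set x | ~ Acc (fun x y : W => x < y) x].
  by exists x.
apply: nm; constructor => y ym; apply: contrapT => /mmin.
by move=> my; move: ym; rewrite ltNge my.
Qed.

Lemma om_ltE (y x : W) : (y < x) = cantor_wo (sval y) (sval x) && (sval y != sval x).
Proof.
rewrite lt_neqAle andbC; congr (_ && ~~ _).
by apply/eqP/eqP => [-> //|]; apply: eq_sig_hprop => ? ? ?; apply: Prop_irrelevance.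
Qed.

Lemma countable_below (x : W) : countable [set y : W | y < x].
Proof.
have := svalP x => /countable_injP[f finj].
apply/countable_injP; exists (f \o sval) => y z; rewrite !inE /= !om_ltE => yx zx fyz.
apply: eq_sig_hprop; first by move=> ? ? ?; exact: Prop_irrelevance.
by apply: finj => //; rewrite inE.
Qed.

(** Otherwise the least real outside this initial segment would have exactly the
members of the segment as predecessors, hence belong to it. *)
Lemma uncountable_omega1 : ~ countable [set: W].
Proof.
move=> Wc; pose A := [set x | countable [set y | cantor_wo y x && (y != x)]].
have Ac : countable A.
  move/countable_injP : Wc => [f finj]; apply/countable_injP.
  exists (fun x => if pselect (A x) is left Ax then f (exist _ x Ax) else 0%N).
  move=> x y; rewrite !inE => Ax Ay; case: pselect => // Ax'.
  case: pselect => // Ay' /finj; rewrite !in_setT => /(_ isT isT).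
  by case.
have [|a nAa amin] := @well_order_min _ _ (~` A) cantor_woP.
  apply/set0P/negP => /eqP AC; apply: uncountable_cantor.
  by rewrite -[[set: _]]setCK setCT -AC setCK in Ac *.
apply: nAa; apply: sub_countable Ac; apply: subset_card_le => y /= /andP[ya yNa].
apply: contrapT => /amin ay; move: yNa; rewrite (well_order_anti cantor_woP (x:=y) (y:=a)) ?eqxx //.
by rewrite ya ay.
Qed.

Lemma countable_bounded (S : set W) : countable S -> exists g, forall x, S x -> x < g.
Proof.
move=> Sc; apply: contrapT => nb; apply: uncountable_omega1.
have -> : [set: W] = \bigcup_(s in S) ([set y | y < s] `|` [set s]).
  rewrite eqEsubset; split => // g _; apply: contrapT => ng; apply: nb; exists g => s Ss.
  rewrite ltNge; apply/negP; rewrite le_eqVlt => /orP[/eqP|] gs; apply: ng; exists s => //=.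
    by right.
  by left.
apply: bigcup_countable => // s _; rewrite -[_ `|` _]bigcup2E.
apply: bigcup_countable => //= -[|[|]] //= _; first exact: countable_below.
Qed.

(** * Ladders, walks, weights and traces *)

(** Enumerate the predecessors of b and take running maxima.  For a successor b the
sequence is eventually constant, which spares a case distinction. *)
Lemma ladder_ex : exists c : W -> nat -> W, forall b a, a < b ->
  [/\ forall n, c b n < b, {homo c b : m n / (m <= n)%N >-> m <= n}
    & exists n, a <= c b n].
Proof.
suff /choice[c cP] : forall b, exists c : nat -> W, forall a, a < b ->
    [/\ forall n, c n < b, {homo c : m n / (m <= n)%N >-> m <= n}
      & exists n, a <= c n].
  by exists c.
move=> b.
have [[x0 x0b]|nb] := pselect (exists x, x < b); last first.
  by exists (fun _ => b) => a ab; case: nb; exists a.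
have /countable_injP[g ginj] := countable_below b.
pose u n := if pselect (exists x, x < b /\ g x = n) is left H then sval (cid H) else x0.
have ub n : u n < b.
  by rewrite /u; case: pselect => // H; case: (svalP (cid H)).
have gu x : x < b -> u (g x) = x.
  move=> xb; rewrite /u; case: pselect => [H|[]]; last by exists x.
  by case: (svalP (cid H)) => Hb /ginj; apply; rewrite inE.
pose c := nat_rect (fun=> W) x0 (fun n y => Order.max y (u n)).
exists c => a ab; split.
- by elim=> [|n IH] //=; rewrite gt_max IH ub.
- move=> m n /subnK <-; elim: (n - m)%N => [|k IH] //=.
  by rewrite le_max IH.
- by exists (g a).+1; rewrite /= le_max gu // lexx orbT.
Qed.

Definition ladder : W -> nat -> W := sval (cid ladder_ex).

Lemma ladder_lt a b n : a < b -> ladder b n < b.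
Proof. by move=> /(svalP (cid ladder_ex))[]. Qed.

Lemma ladder_homo a b : a < b -> {homo ladder b : m n / (m <= n)%N >-> m <= n}.
Proof. by move=> /(svalP (cid ladder_ex))[]. Qed.

Lemma ladder_cofinal a b : a < b -> exists n, a <= ladder b n.
Proof. by move=> /(svalP (cid ladder_ex))[]. Qed.

Definition rung (a b : W) : nat :=
  if pselect (exists n, a <= ladder b n) is left H then ex_minn H else 0.

Definition walk_next (a b : W) : W := ladder b (rung a b).

Lemma rungP a b n : a < b -> (n < rung a b)%N = (ladder b n < a).
Proof.
move=> ab; rewrite /rung; case: pselect => [H|[]]; last exact: ladder_cofinal ab.
case: ex_minnP => m am mmin; rewrite ltNge; apply/idP/idP => [nm|].
  by apply/negP => /mmin; rewrite leqNgt nm.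
apply: contraR; rewrite -leqNgt => mn; apply: le_trans am _.
exact: ladder_homo ab _ _ mn.
Qed.

Lemma rung_eq a b n : a < b -> a <= ladder b n ->
  (forall m, (m < n)%N -> ladder b m < a) -> rung a b = n.
Proof.
move=> ab an nmin; apply/eqP; rewrite eqn_leq leqNgt rungP // -leNgt an /=.
case: n an nmin => // n _ nmin; by rewrite rungP // nmin.
Qed.

Lemma walk_next_lt a b : a < b -> walk_next a b < b.
Proof. exact: ladder_lt. Qed.

Lemma le_walk_next a b : a < b -> a <= walk_next a b.
Proof. by move=> ab; rewrite leNgt -rungP // ltnn. Qed.

Section Walk.
Variables (X : Type) (x0 : X) (f : W -> X -> X) (a : W).

Definition walk_step (b : W) (rec : forall c : W, c < b -> X) : X :=
  if pselect (a < b) is left ab then f b (rec (walk_next a b) (walk_next_lt ab)) else x0.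

Definition walk : W -> X := Fix om_wf (fun=> X) walk_step.

Lemma walkE b : walk b = if a < b then f b (walk (walk_next a b)) else x0.
Proof.
rewrite /walk Fix_eq; first by rewrite {1}/walk_step; case: pselect => [->|/negP/negbTE->].
by move=> c g h gh; rewrite /walk_step; case: pselect => // ac; rewrite gh.
Qed.
End Walk.

(** Todorcevic's function rho_1: the largest index of a rung used on the walk from b
down to a. *)
Definition weight (b a : W) : nat := walk 0 (fun b r => maxn (rung a b) r) a b.

(** Moore's lower trace: the running maxima of the last rungs below a of the ladders
met on the walk from b to a, in increasing order. *)
Definition trace (a b : W) : seq W :=
  walk [::] (fun b s =>
    if rung a b is n.+1 then ladder b n :: [seq y <- s | ladder b n < y] else s) a b.

Lemma weightE a b : a < b -> weight b a = maxn (rung a b) (weight (walk_next a b) a).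
Proof. by move=> ab; rewrite /weight walkE ab. Qed.

Lemma tracexx a : trace a a = [::].
Proof. by rewrite /trace walkE ltxx. Qed.

Lemma traceE a b : a < b -> trace a b =
  if rung a b is n.+1 then
    ladder b n :: [seq y <- trace a (walk_next a b) | ladder b n < y]
  else trace a (walk_next a b).
Proof. by move=> ab; rewrite {1}/trace walkE ab. Qed.

Lemma trace_lt a b x : x \in trace a b -> x < a.
Proof.
elim/(well_founded_ind om_wf) : b => b IH.
have [ab|ba] := boolP (a < b); last by rewrite /trace walkE (negbTE ba).
rewrite traceE //; case E : (rung a b) => [|n].
  exact/IH/walk_next_lt.
rewrite inE => /orP[/eqP ->|]; first by rewrite -rungP // E.
by rewrite mem_filter => /andP[_]; exact/IH/walk_next_lt.
Qed.

(** A point a < b with weight at most n lies at, or is reached through, one of the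
rungs of b of index at most n; conclude by induction on b. *)
Lemma finite_weight_le b n : finite_set [set a | a < b /\ (weight b a <= n)%N].
Proof.
elim/(well_founded_ind om_wf) : b => b IH.
have [[x xb]|nb] := pselect (exists x, x < b); last first.
  by apply: sub_finite_set (finite_set0 _) => a [ab _]; apply: nb; exists a.
apply: (@sub_finite_set _ _ (\bigcup_(j in `I_n.+1) ([set ladder b j] `|`
   [set a | a < ladder b j /\ (weight (ladder b j) a <= n)%N]))).
  move=> a [ab]; rewrite weightE // geq_max => /andP[rn wn]; exists (rung a b).
    by rewrite /= ltnS.
  have := le_walk_next ab; rewrite le_eqVlt => /orP[/eqP an|an].
    by left.
  by right.
apply: bigcup_finite => // j _; rewrite finite_setU; split; first exact: finite_set1.
exact/IH/ladder_lt/xb.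
Qed.

(** Let j be the rung at which the walk from b to x < a starts; there are finitely many
such j, as j is at most the rung for a.  By induction weights to x from the j-th rung
and from walk_next a b agree for almost all x, and they exceed j for almost all x;
then weight b x is that common value. *)
Lemma weight_coherent a b : a <= b ->
  finite_set [set x | x < a /\ weight a x != weight b x].
Proof.
move: a; elim/(well_founded_ind om_wf) : b => b IH a.
rewrite le_eqVlt => /orP[/eqP ->|ab].
  by apply: sub_finite_set (finite_set0 _) => x [_]; rewrite eqxx.
set b1 := walk_next a b; have b1b : b1 < b := walk_next_lt ab.
have ab1 : a <= b1 := le_walk_next ab.
apply: (@sub_finite_set _ _ ([set x | x < a /\ weight a x != weight b1 x] `|`
  \bigcup_(j in `I_(rung a b).+1) ([set ladder b j] `|`
   ([set x | x < ladder b j /\ (weight (ladder b j) x <= j)%N] `|`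
   [set x | x < ladder b j /\ weight (ladder b j) x != weight b1 x])))).
  move=> x [xa wx]; have xb := lt_trans xa ab.
  have [wab1|] := boolP (weight a x == weight b1 x); last by left.
  right; have rr : (rung x b <= rung a b)%N.
    rewrite leqNgt rungP // -leNgt; apply: le_trans (ltW xa) _; exact: ab1.
  exists (rung x b); first by rewrite /= ltnS.
  have := le_walk_next xb; rewrite le_eqVlt => /orP[/eqP xE|xn].
    by left.
  right; have [le|] := leqP (weight (walk_next x b) x) (rung x b); first by left.
  move=> lt; right; split => //; apply: contraNN wx => /eqP.
  rewrite -/(walk_next x b) (eqP wab1) => <-; rewrite (weightE xb).
  by apply/eqP; symmetry; apply/maxn_idPr/ltnW.
rewrite finite_setU; split; first exact: IH.
apply: bigcup_finite => // j; rewrite /= ltnS => jr; rewrite !finite_setU.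
split; [exact: finite_set1|split; first exact: finite_weight_le].
by apply: IH => //; apply: ladder_homo ab _ _ jr.
Qed.

Definition all_lt (s : seq W) (x : W) := all (fun y => y < x) s.
Definition all_ge (s : seq W) (x : W) := all (fun y => x <= y) s.

(** Under these hypotheses the walks from c to a and from c to b use the same rungs until
the walk from c has arrived at b. *)
Lemma trace_cat a b c : a <= b -> b <= c -> all_lt (trace b c) a ->
  (forall x y, x \in trace b c -> y \in trace a b -> x < y) ->
  trace a c = trace b c ++ trace a b.
Proof.
move=> ab; elim/(well_founded_ind om_wf) : c => c IH.
rewrite le_eqVlt => /orP[/eqP <- _ _|bc]; first by rewrite tracexx.
have ac : a < c := le_lt_trans ab bc.
move=> ta tab.
have rr : rung a c = rung b c.
  apply: rung_eq => //; first exact: le_trans ab (le_walk_next bc).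
  move=> m mr; have : m = (rung b c).-1 \/ (m <= (rung b c).-1)%N by right; case: (rung b c) mr.
  move: ta; rewrite traceE //; case: (rung b c) mr => // n; rewrite ltnS => mn.
  move=> /andP[na _] _; apply: le_lt_trans na; exact: ladder_homo ac _ _ mn.
have nn : walk_next a c = walk_next b c by rewrite /walk_next rr.
move: ta tab; rewrite (traceE ac) (traceE bc) rr nn.
case E : (rung b c) => [|n] ta tab.
  by apply: IH => //; [exact: walk_next_lt|exact: le_walk_next].
have na : ladder c n < a by move: ta => /andP[].
have nab y : y \in trace a b -> ladder c n < y by apply: tab; rewrite mem_head.
rewrite (IH (walk_next b c)) //; first last.
- move=> x y xb yb; have [xn|nx] := leP x (ladder c n); first exact: le_lt_trans (nab _ yb).
  by apply: tab => //; rewrite inE mem_filter nx xb orbT.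
- apply/allP => x xb; have [xn|nx] := leP x (ladder c n); first exact: le_lt_trans na.
  by move: ta => /allP; apply; rewrite inE mem_filter nx xb orbT.
- exact: le_walk_next.
- exact: walk_next_lt.
rewrite filter_cat /= ; congr (_ :: _ ++ _); apply/all_filterP/allP => y; exact: nab.
Qed.

Definition is_limit (d : W) := forall g, g < d -> exists2 x, g < x & x < d.

(** The head of trace x d is the last rung of d below x, and it is the least element. *)
Lemma trace_limit d g : is_limit d -> g < d -> exists2 g', g' < d &
  forall x, g' < x -> x < d -> trace x d != [::] /\ all_ge (trace x d) g.
Proof.
move=> dl gd; have [g2 gg2 g2d] := dl g gd.
have [n gn] := ladder_cofinal g2d; exists (ladder d n); first exact: ladder_lt gd.
move=> x nx xd; rewrite traceE //.
have := nx; rewrite -rungP //; case: (rung x d) => // m; rewrite ltnS => nm.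
have gm : g <= ladder d m.
  apply: le_trans (ladder_homo xd nm); exact: ltW (lt_le_trans gg2 gn).
split => //; apply/allP => y; rewrite inE => /orP[/eqP -> //|].
by rewrite mem_filter => /andP[my _]; apply: le_trans gm (ltW my).
Qed.

Lemma exists_above (d : W) : exists e : W, d < e.
Proof. by have [g gP] := countable_bounded (countable1 d); exists g; apply: gP. Qed.

Lemma unbounded_finite_sup (d x0 : W) (S : set W) : is_limit d -> x0 < d ->
  finite_set S -> (forall x, S x -> x < d) -> exists2 g, g < d & forall x, S x -> x < g.
Proof.
move=> dl x0d /finite_seqP[s ->]; elim: s => [|y s IH] sd; first by exists x0.
have [|g gd gP] := IH; first by move=> x xs; apply: sd; rewrite /= inE; apply/orP; right.
have yd : y < d by apply: sd; rewrite /= mem_head.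
have [y' yy' y'd] := dl y yd; exists (Order.max g y'); first by rewrite gt_max gd.
move=> x; rewrite /= inE => /orP[/eqP ->|xs]; first by rewrite lt_max yy' orbT.
by rewrite lt_max gP.
Qed.

(** * Reflection *)

(** A substitute for elementary submodels: d reflects countably many existential
statements with parameters below d.  It is the supremum of an increasing sequence
whose next term exceeds witnesses for all the countably many parameters below the
previous term. *)
Lemma reflection (P : countType) (Q : seq (seq W) -> P -> W -> Prop) :
  exists d, [/\ is_limit d, exists x, x < d & forall ss p,
    all (all_lt^~ d) ss -> (exists x, Q ss p x) -> exists2 x, x < d & Q ss p x].
Proof.
(* a witness for the statement with parameters ss, p if there is one, else any point *)
pose wit ss p x := if pselect (exists x, Q ss p x) is left H then sval (cid H) else x.
have up g : exists e, g < e /\ forall ss p, all (all_lt^~ g) ss -> wit ss p g < e.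
  have [|e eP] := @countable_bounded (g |` [set wit sp.1 sp.2 g | sp in
      [set sp : seq (seq W) * P | all (all_lt^~ g) sp.1]]).
    apply: (@sub_countable _ _ _ (\bigcup_(i in [set: bool]) if i then [set g] else
      [set wit sp.1 sp.2 g | sp in [set sp : seq (seq W) * P | all (all_lt^~ g) sp.1]])).
      apply: subset_card_le => x /= [->|]; [by exists true|by exists false].
    apply: bigcup_countable => // -[] _ //.
    apply: sub_countable (card_image_le _ _) _.
    have /countable_injP[f finj] := countable_below g.
    apply/countable_injP; exists (fun sp => pickle ([seq [seq f x | x <- s] | s <- sp.1], sp.2)).
    move=> [ss p] [ss' p']; rewrite !inE /= => ssg ss'g /(pcan_inj pickleK) [E ->].
    congr pair; elim: ss ss' E ssg ss'g => [|s ss IH] [|s' ss'] //= [E /IH{}IH].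
    move=> /andP[sg ssg] /andP[s'g ss'g]; congr cons; last exact: IH.
    elim: s s' E sg s'g {IH ssg ss'g} => [|x s IH] [|x' s'] //= [E /IH{}IH].
    move=> /andP[xg sg] /andP[x'g s'g]; congr cons; last exact: IH.
    by apply: finj; rewrite ?inE.
  exists e; split=> [|ss p ssg]; first by apply: eP; left.
  by apply: eP; right; exists (ss, p).
have [nx nxP] := choice up.
have [g0 _] := @countable_bounded set0 (countable0 _).
pose dn := nat_rect (fun=> W) g0 (fun _ => nx).
have dnS n : dn n < dn n.+1 by case: (nxP (dn n)).
have dn_mono m n : (m <= n)%N -> dn m <= dn n.
  move=> /subnK <-; elim: (n - m)%N => [|k IH] //.
  by apply: le_trans IH _; apply: ltW; exact: dnS.
have [|d dub dmin] := @om_min_ex [set x | forall n, dn n <= x].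
  have [|x xP] := @countable_bounded (range dn); first exact: sub_countable (card_image_le _ _) _.
  by exists x => n; apply/ltW/xP; exists n.
have below_d x : x < d -> exists n, x < dn n.
  move=> xd; apply: contrapT => nn; have : d <= x.
    by apply: dmin => n; rewrite leNgt; apply/negP => xn; apply: nn; exists n.
  by rewrite leNgt xd.
have dn_lt n : dn n < d by apply: lt_le_trans (dnS n) _; exact: dub.
exists d; split; first by move=> g /below_d[n gn]; exists (dn n).
  by exists (dn 0%N).
move=> ss p ssd Qx; have [n ssn] : exists n, all (all_lt^~ (dn n)) ss.
  have seq_below s : all_lt s d -> exists n, all_lt s (dn n).
    elim: s => [|x s IH] /=; first by exists 0%N.
    move=> /andP[/below_d[n xn] /IH[m sm]]; exists (maxn n m); apply/andP; split.
      by apply: lt_le_trans xn _; apply: dn_mono; rewrite leq_maxl.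
    apply/allP => y /(allP sm) ym; apply: lt_le_trans ym _; apply: dn_mono.
    by rewrite leq_maxr.
  elim: ss ssd {Qx} => [|s ss IH] /=; first by exists 0%N.
  move=> /andP[/seq_below[n sn] /IH[m ssm]]; exists (maxn n m); apply/andP; split.
    by apply/allP => y /(allP sn) ym; apply: lt_le_trans ym _; apply: dn_mono; rewrite leq_maxl.
  apply/allP => t /(allP ssm)/allP tm; apply/allP => y /tm ym; apply: lt_le_trans ym _.
  by apply: dn_mono; rewrite leq_maxr.
have [_ /(_ ss p ssn)] := nxP (dn n); rewrite /wit; case: pselect => // H lt.
exists (sval (cid H)); last exact: svalP (cid H).
by apply: lt_trans lt _; exact: dn_lt n.+1.
Qed.

Definition unbounded_family (A : set (seq W)) := forall g, exists2 a, A a & all_ge a g.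

(** Otherwise there would be one N and infinitely many finite sets l_0 < l_1 < ... such
that every a far enough out has, for each n, an element of weight at most N at some
point of l_n.  As a is finite, this contradicts finite_weight_le. *)
Lemma large_weights (A : set (seq W)) : unbounded_family A ->
  exists g, forall l, all_ge l g -> forall N h, exists a, [/\ A a, all_ge a h &
    forall x z, x \in a -> z \in l -> (N < weight x z)%N].
Proof.
move=> Au; apply: contrapT => ng.
pose light (N : nat) (l a : seq W) := exists x z, [/\ x \in a, z \in l & (weight x z <= N)%N].
pose bound (N : nat) (g : W) (l : seq W) (h : W) :=
  all_ge l g /\ forall a, A a -> all_ge a h -> light N l a.
(* bound N g l h: the set l lies above g and refutes the conclusion for N and h *)
have bad g : exists N l h, bound N g l h.
  apply: contrapT => nb; apply: ng; exists g => l lg N h; apply: contrapT => na.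
  apply: nb; exists N, l, h; split => // a Aa ah; apply: contrapT => nx.
  apply: na; exists a; split => // x z xa zl; rewrite ltnNge; apply/negP => wN.
  by apply: nx; exists x, z.
(* one N serves cofinally many g, hence all, since omega_1 is not a countable union
   of bounded sets *)
have [N NP] : exists N, forall g, exists l h, bound N g l h.
  apply: contrapT => nN.
  have /choice[gN gNP] : forall N, exists g, ~ exists l h, bound N g l h.
    move=> N; apply: contrapT => nng; apply: nN; exists N => g.
    by apply: contrapT => ?; apply: nng; exists g.
  have [|g gP] := @countable_bounded (range gN); first exact: sub_countable (card_image_le _ _) _.
  have [N [l [h [lg H]]]] := bad g; apply: (gNP N); exists l, h; split => //.
  by apply/allP => z /(allP lg); apply: le_trans; apply/ltW/gP; exists N.
have nxt g : exists lhg : (seq W * W) * W,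
    [/\ all_ge lhg.1.1 g, all_lt lhg.1.1 lhg.2, g <= lhg.2 &
      forall a, A a -> all_ge a lhg.1.2 -> light N lhg.1.1 a].
  have [l [h [lg H]]] := NP g.
  have [|g' g'P] := @countable_bounded (g |` [set` l]).
    apply: finite_set_countable; rewrite finite_setU.
    by split; [exact: finite_set1|exact: finite_seq].
  exists (l, h, g'); split => //=; first by apply/allP => z zl; apply: g'P; right.
  by apply/ltW/g'P; left.
have [nx nxP] := choice nxt.
have [g0 _] := @countable_bounded set0 (countable0 _).
pose gn := nat_rect (fun=> W) g0 (fun _ g => (nx g).2).
pose ln n := (nx (gn n)).1.1; pose hn n := (nx (gn n)).1.2.
have gn_mono m n : (m <= n)%N -> gn m <= gn n.
  move=> /subnK <-; elim: (n - m)%N => [|k IH] //.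
  by apply: le_trans IH _; case: (nxP (gn (k + m)%N)).
have [|e eP] := @countable_bounded (range hn `|` range gn).
  rewrite -bigcup2E; apply: bigcup_countable => // -[|[|]] //= _;
  exact: sub_countable (card_image_le _ _) _.
have [a Aa ae] := Au e.
have /choice[xz xzP] : forall n, exists xz : W * W,
    [/\ xz.1 \in a, xz.2 \in ln n & (weight xz.1 xz.2 <= N)%N].
  move=> n; have [_ _ _ /(_ a Aa)] := nxP (gn n); case.
    by apply/allP => x /(allP ae); apply: le_trans; apply/ltW/eP; left; exists n.
  by move=> x [z [xa zl wN]]; exists (x, z).
have zlt n : (xz n).2 < gn n.+1.
  by have [_ zl _] := xzP n; have [_ /allP lt _ _] := nxP (gn n); apply: lt.
have zge n : gn n <= (xz n).2.
  by have [_ zl _] := xzP n; have [/allP ge _ _ _] := nxP (gn n); apply: ge.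
have zinj : injective (fun n => (xz n).2).
  have aux m n : (m < n)%N -> (xz m).2 < (xz n).2.
    by move=> mn; apply: lt_le_trans (zlt m) _; apply: le_trans (zge n); apply: gn_mono.
  move=> m n E; have [/aux|/aux|//] := ltngtP m n; by rewrite E ltxx.
have fin : finite_set (\bigcup_(x in [set` a]) [set z | z < x /\ (weight x z <= N)%N]).
  by apply: bigcup_finite => [|x _]; [exact: finite_seq|exact: finite_weight_le].
have : finite_set (range (fun n => (xz n).2)).
  apply: sub_finite_set fin => z [n _ <-]; have [xa _ wN] := xzP n; exists (xz n).1 => //.
  split => //; apply: lt_le_trans (zlt n) _; apply: le_trans (allP ae _ xa).
  by apply/ltW/eP; right; exists n.+1.
move=> /(finite_preimage (in2W zinj)) finN; apply: infinite_nat.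
by apply: sub_finite_set finN => n _; exists n.
Qed.

(** * The oscillation theorem *)

(** The argument p plays the role of an entry preceding the list, so that concatenation
is handled exactly; starting from true, an initial true is not counted. *)
Fixpoint ascents (p : bool) (s : bitseq) : nat :=
  if s is q :: s' then (~~ p && q + ascents q s')%N else 0.

Lemma ascents_cat p s t : ascents p (s ++ t) = (ascents p s + ascents (last p s) t)%N.
Proof. by elim: s p => [|q s IH] p //=; rewrite IH addnA. Qed.

Lemma ascents_nseq p n q : ascents p (nseq n.+1 q) = ~~ p && q.
Proof.
rewrite /= -[RHS]addn0; congr addn.
by elim: n => [|n IH] //=; rewrite IH addn0 andNb.
Qed.

Lemma last_nseqS (p : bool) n q : last p (nseq n.+1 q) = q.
Proof. by elim: n p => [|n IH] p //=; rewrite -[RHS](IH q). Qed.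

Definition osc (a b : W) : nat :=
  ascents true [seq (weight b x < weight a x)%N | x <- trace a b].

(** The finite amount of information on the weights of a that is preserved when a is
replaced by another member of its family. *)
Definition profile (F a : seq W) : seq (seq nat) := [seq [seq weight x z | z <- F] | x <- a].

Lemma profile_size F a a' : profile F a = profile F a' -> size a = size a'.
Proof. by move=> /(congr1 size); rewrite !size_map. Qed.

Lemma profile_nth F a a' d i z : profile F a = profile F a' -> (i < size a)%N -> z \in F ->
  weight (nth d a i) z = weight (nth d a' i) z.
Proof.
move=> E ia zF; have ia' : (i < size a')%N by rewrite -(profile_size E).
have := congr1 (fun t => nth [::] t i) E; rewrite /profile !(nth_map d) // => E2.
have := congr1 (fun t => nth 0 t (index z F)) E2.
by rewrite !(nth_map d) ?index_mem // nth_index.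
Qed.

Lemma profile_catl F l a a' :
  profile (F ++ l) a = profile (F ++ l) a' -> profile F a = profile F a'.
Proof.
move=> /(congr1 (map (take (size F)))); rewrite /profile -!map_comp.
have E b :
    [seq (take (size F) \o (fun x => [seq weight x z | z <- F ++ l])) x | x <- b] = profile F b.
  by apply: eq_map => x /=; rewrite map_cat take_size_cat // size_map.
by rewrite !E.
Qed.

Section Oscillation.
Variables (A B : set (seq W)).

(** The point x bears the same relation to some a in A and b in B as the reflecting
point d does to the given ones: same weights on F, same traces Ls, weights that
coincide with those of x from g0 on, and traces from x staying above g0. *)
Definition mirror (F : seq W) (g0 g1 : W) (Ls : seq (seq W)) (pa pb : seq (seq nat)) (x : W) :=
  exists a b, [/\ [/\ A a, B b, all_ge a x & all_ge b x],
    [/\ profile F a = pa, profile F b = pb & [seq trace x y | y <- b] = Ls],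
    forall z, g0 <= z -> z < x -> forall y, y \in a ++ b -> weight y z = weight x z &
    forall z, g1 < z -> z < x -> trace z x != [::] /\ all_ge (trace z x) g0].

(** The four statements reflected to d, with parameters packed into lists: an upper
bound for the points satisfying mirror, a point that no member of A with a given
profile lies beyond, the threshold of large_weights for these members, and a bound
for one of them that lies beyond given points. *)
Definition closure_demand (ss : seq (seq W)) (p : nat * (seq (seq nat) * seq (seq nat)))
    (x : W) :=
  match p.1 with
  | 0 => forall y, mirror (nth [::] ss 0) (head x (nth [::] ss 1)) (last x (nth [::] ss 1))
           (drop 2 ss) p.2.1 p.2.2 y -> y < x
  | 1 => forall a, A a -> profile (nth [::] ss 0) a = p.2.1 -> ~ all_ge a x
  | 2 => forall l, all_ge l x -> forall N h,
           exists a, [/\ A a /\ profile (nth [::] ss 0) a = p.2.1, all_ge a h &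
             forall y z, y \in a -> z \in l -> (N < weight y z)%N]
  | _ => exists a, [/\ A a, profile (nth [::] ss 0) a = p.2.1,
           forall y z, y \in a -> z \in nth [::] ss 1 -> z < y & all_lt a x]
  end.

Variable d : W.
Hypotheses (dlim : is_limit d) (d0 : exists x, x < d)
  (dref : forall ss p, all (all_lt^~ d) ss ->
    (exists x, closure_demand ss p x) -> exists2 x, x < d & closure_demand ss p x).

Lemma coherence_bound (s : seq W) : all_ge s d ->
  exists2 g, g < d & forall z, g <= z -> z < d -> forall y, y \in s -> weight y z = weight d z.
Proof.
move=> sd; have [x0 x0d] := d0.
have [||g gd gP] := @unbounded_finite_sup d x0
    (\bigcup_(y in [set` s]) [set z | z < d /\ weight d z != weight y z]) dlim x0d.
- apply: bigcup_finite => [|y /= ys]; first exact: finite_seq.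
  exact/weight_coherent/(allP sd).
- by move=> x [y _ []].
exists g => // z gz zd y ys; apply/eqP; apply: contraTT gz => wz.
by rewrite -ltNge; apply: gP; exists y => //; split=> //; rewrite eq_sym.
Qed.

(** The finite set F contains everything on which the weights of a and b have been
fixed so far. *)
Record stage (F a b : seq W) : Prop := Stage {
  stageA : A a; stageB : B b; stage_a : all_ge a d; stage_b : all_ge b d;
  stageF : all_lt F d; stageL : forall y, y \in b -> {subset trace d y <= F} }.

Definition extends F a b l a' b' :=
  [/\ l != [::], stage (F ++ l) a' b', profile F a' = profile F a & profile F b' = profile F b] /\
  [seq trace d y | y <- b'] = [seq trace d y ++ l | y <- b].

(** The point d satisfies mirror, so by reflection the points satisfying it are
unbounded.  Take x > d satisfying it, with witnesses a' and b'.  The trace from d to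
a member of b' is the old trace followed by l = trace d x, and on l the weights of
all members of a' and b' coincide with that of x. *)
Lemma extend_eq F a b g : stage F a b -> g < d -> exists l a' b',
  [/\ extends F a b l a' b', all_ge l g &
    forall x y z, x \in a' -> y \in b' -> z \in l -> weight x z = weight y z].
Proof.
move=> [Aa Bb ad bd Fd LF] gd; have [x0 x0d] := d0.
have [g1 g1d g1P] : exists2 g1, g1 < d & forall z, g1 <= z -> z < d ->
    forall y, y \in a ++ b -> weight y z = weight d z.
  by apply: coherence_bound; rewrite /all_ge all_cat; apply/andP.
have [||g2 g2d g2P] := @unbounded_finite_sup d x0 [set` F] dlim x0d.
- exact: finite_seq.
- by move=> x /(allP Fd).
(* beyond g0 the weights agree with those of d, and g0 exceeds F *)
pose g0 := Order.max g (Order.max g1 g2).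
have g0d : g0 < d by rewrite !gt_max gd g1d g2d.
have [g3 g3d g3P] := trace_limit dlim g0d.
pose Ls := [seq trace d y | y <- b].
have md : mirror F g0 g3 Ls (profile F a) (profile F b) d.
  exists a, b; split => // z g0z zd y yab; apply: g1P => //.
  by apply: le_trans g0z; rewrite !le_max lexx orbT.
(* otherwise the points satisfying mirror are bounded, hence bounded below d by
   reflection, whereas d satisfies it *)
have [x dx [a' [b' [[Aa' Bb' a'x b'x] [pa pb LE] wx tx]]]] :
    exists2 x, d < x & mirror F g0 g3 Ls (profile F a) (profile F b) x.
  have [e de] := exists_above d; apply: contrapT => nx.
  have [||u ud] := @dref (F :: [:: g0; g3] :: Ls) (0%N, (profile F a, profile F b)).
  - rewrite /= Fd g0d g3d /=; apply/allP => t /mapP[y yb ->].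
    by apply/allP => z /(LF _ yb) /(allP Fd).
  - exists e => y /=; rewrite drop0 => my; apply: le_lt_trans _ de; rewrite leNgt.
    by apply/negP => dy; apply: nx; exists y.
  by move=> /(_ d) /=; rewrite drop0 => /(_ md); rewrite ltNge (ltW ud).
pose l := trace d x.
have [lN0 lge] : l != [::] /\ all_ge l g0 by apply: tx.
have ld z : z \in l -> z < d by apply: trace_lt.
have trx y : y \in b' -> {subset trace x y <= F}.
  move=> yb' z zy; have : trace x y \in Ls by rewrite -LE map_f.
  by move=> /mapP[y0 y0b E]; apply: LF y0b _ _; rewrite -E.
have trd y : y \in b' -> trace d y = trace x y ++ l.
  move=> yb'; apply: trace_cat; [exact: ltW|exact: (allP b'x)| |].
    by apply/allP => z /(trx _ yb') /(allP Fd).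
  move=> u v /(trx _ yb') /g2P ug2 /(allP lge); apply: lt_le_trans.
  by rewrite /g0 !lt_max ug2 !orbT.
exists l, a', b'; split.
- split; last first.
    rewrite (_ : [seq trace d y ++ l | y <- b] = [seq t ++ l | t <- Ls]); last by rewrite -map_comp.
    by rewrite -LE -map_comp; apply/eq_in_map => y /trd.
  split => //; split => //.
  + by apply/allP => y /(allP a'x); apply/le_trans/ltW.
  + by apply/allP => y /(allP b'x); apply/le_trans/ltW.
  + by rewrite /all_lt all_cat; apply/andP; split => //; apply/allP => z /ld.
  + move=> y yb' z; rewrite trd // !mem_cat => /orP[/(trx _ yb') ->|->] //.
    by rewrite orbT.
- by apply/allP => z /(allP lge); apply: le_trans; rewrite le_max lexx.
- move=> u v z ua vb zl; have zx : z < x := lt_trans (ld _ zl) dx.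
  have g0z := allP lge _ zl.
  by rewrite !wx ?mem_cat ?ua ?vb ?orbT.
Qed.

Lemma patterned_unbounded F a b : stage F a b ->
  unbounded_family [set a' | A a' /\ profile F a' = profile F a].
Proof.
move=> [Aa _ ad _ Fd _] g; apply: contrapT => ng.
have [||u ud /(_ a)] := @dref [:: F] (1%N, (profile F a, [::])).
- by rewrite /= Fd.
- by exists g => a' Aa' pa' a'g; apply: ng; exists a'.
by apply => //; apply/allP => x /(allP ad); apply/le_trans/ltW.
Qed.

(** For r = false this is extend_eq.  For r = true the new part l of the traces is
produced first, far enough out for large_weights to apply, and then a is replaced
by a member of A with the same profile whose weights on l exceed those of b'. *)
Lemma extend (r : bool) F a b : stage F a b -> exists l a' b',
  extends F a b l a' b' /\
  forall x y z, x \in a' -> y \in b' -> z \in l -> (weight y z < weight x z)%N = r.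
Proof.
move=> gd; have [x0 x0d] := d0; case: r; last first.
  have [l [a' [b' [E _ W]]]] := extend_eq gd x0d; exists l, a', b'; split => // x y z xa yb zl.
  by rewrite (W x y) // ltnn.
have [||g gltd gP] := @dref [:: F] (2%N, (profile F a, [::])).
- by rewrite /= (stageF gd).
- by have [g gP] := large_weights (patterned_unbounded gd); exists g.
have [l [a' [b' [[[lN0 gd' pa pb] LE] lg _]]]] := extend_eq gd gltd.
have [a2 [[Aa2 pa2] a2d wa2]] := gP l lg (\max_(y <- b') \max_(z <- l) weight y z) d.
exists l, a2, b'; split.
  split => //; split => //; case: gd' => *; split => //.
move=> x y z xa yb zl; apply: leq_ltn_trans (wa2 _ _ xa zl).
apply: leq_trans (leq_bigmax_seq _ yb _) => //.
exact: (@leq_bigmax_seq _ _ _ (fun z => weight y z)).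
Qed.

(** The part of the pattern defining osc that lives on the trace from d. *)
Definition word (x y : W) : bitseq := [seq (weight y z < weight x z)%N | z <- trace d y].

Lemma word_extends (r : bool) F a b l a' b' : stage F a b -> extends F a b l a' b' ->
  (forall x y z, x \in a' -> y \in b' -> z \in l -> (weight y z < weight x z)%N = r) ->
  [/\ size a' = size a, size b' = size b & forall i j, (i < size a)%N -> (j < size b)%N ->
  word (nth d a' i) (nth d b' j) = word (nth d a i) (nth d b j) ++ nseq (size l) r].
Proof.
move=> gd [[lN0 gd' pa pb] LE] H; have sa := profile_size pa; have sb := profile_size pb.
split => // i j ia jb.
have LEj : trace d (nth d b' j) = trace d (nth d b j) ++ l.
  have := congr1 (fun t => nth [::] t j) LE.
  by rewrite !(nth_map d) ?sb.
rewrite /word LEj map_cat; congr cat.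
  apply/eq_in_map => z zt; have zF : z \in F by apply: (stageL gd) zt; exact: mem_nth.
  by rewrite (profile_nth d pa) ?sa // (profile_nth d pb) ?sb.
transitivity [seq r | _ <- l]; last by elim: (l) => //= ? ? ->.
by apply/eq_in_map => z zl; apply: H => //; apply: mem_nth; rewrite ?sa ?sb.
Qed.

(** Extending first by equal weights and then by larger weights appends one block of
false and one block of true to all words at the same time: every number of ascents
increases by exactly one, and every word ends with true. *)
Lemma climb (a0 b0 : seq W) : A a0 -> B b0 -> all_ge a0 d -> all_ge b0 d ->
  forall n, exists F a (bs : nat -> seq W), stage F a (bs n) /\ forall m, (m <= n)%N ->
  [/\ B (bs m), all_ge (bs m) d, size (bs m) = size (bs 0%N),
   forall y, y \in bs m -> {subset trace d y <= F} &
   forall i j, (i < size a)%N -> (j < size (bs 0%N))%N ->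
    let w m := word (nth d a i) (nth d (bs m) j) in
    ascents true (w m) = (ascents true (w 0%N) + m)%N /\ last true (w m) = true].
Proof.
move=> Aa0 Bb0 a0d b0d; elim=> [|n [F [a [bs [gd H]]]]].
  pose F := flatten [seq trace d y | y <- b0].
  have gd : stage F a0 b0.
    split => //.
      by apply/allP => z /flatten_mapP[y _ /trace_lt].
    by move=> y yb z zy; apply/flatten_mapP; exists y.
  have [l [a [b [E WE]]]] := extend true gd.
  have [sa sb WW] := word_extends gd E WE; case: E => -[lN0 gd' _ _] _.
  exists (F ++ l), a, (fun=> b); split => // m; rewrite leqn0 => /eqP ->.
  split => //; [exact: stageB gd'|exact: stage_b gd'|exact: stageL gd'|].
  move=> i j; rewrite sa sb => ia jb /=; rewrite addn0 WW //; split => //.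
  by rewrite last_cat; case: (l) lN0 => // ? ? _; apply: last_nseqS.
have [l1 [a1 [b1 [E1 WE1]]]] := extend false gd.
have [sa1 sb1 WW1] := word_extends gd E1 WE1; case: E1 => -[l1N0 gd1 pa1 _] _.
have [l2 [a2 [b2 [E2 WE2]]]] := extend true gd1.
have [sa2 sb2 WW2] := word_extends gd1 E2 WE2; case: E2 => -[l2N0 gd2 pa2 _] _.
(* the sets bs 0, ..., bs n are kept: the new a2 has the same weights on their traces *)
pose bs' m := if (m <= n)%N then bs m else b2.
have bs'n : bs' n.+1 = b2 by rewrite /bs' ltnn.
have sn : size (bs n) = size (bs 0%N) by have [_ _] := H n (leqnn n).
exists ((F ++ l1) ++ l2), a2, bs'; rewrite bs'n; split => // m.
have patF : profile F a2 = profile F a by rewrite -pa1; apply: profile_catl pa2.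
have wE k i j : (k <= n)%N -> (i < size a2)%N -> (j < size (bs 0%N))%N ->
    word (nth d a2 i) (nth d (bs k) j) = word (nth d a i) (nth d (bs k) j).
  move=> kn ia jb; apply/eq_in_map => z zt; congr (_ < _)%N.
  have [_ _ sk Fk _] := H k kn.
  by apply: (profile_nth d patF ia); apply: Fk zt; apply: mem_nth; rewrite sk.
rewrite leq_eqVlt ltnS => /orP[/eqP ->|mn].
  rewrite bs'n; split; [exact: stageB gd2|exact: stage_b gd2|by rewrite sb2 sb1|exact: stageL gd2|].
  move=> i j ia2 jb /=; rewrite bs'n /bs' leq0n wE //.
  have ia : (i < size a)%N by rewrite -sa1 -sa2.
  rewrite WW2 ?sa1 ?sb1 ?sn // WW1 ?sn //.
  have [_ _ _ _ /(_ i j ia jb) [E0 E1]] := H n (leqnn n).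
  rewrite !ascents_cat !last_cat E0 E1.
  case: (l1) l1N0 => // ? l1' _; case: (l2) l2N0 => // ? l2' _.
  by rewrite !last_nseqS !ascents_nseq /= addn0 -addnA addn1.
have [Bm bmd sm Fm Hm] := H m mn; rewrite /bs' mn leq0n; split => //.
  by move=> y yb z zt; rewrite !mem_cat (Fm y yb z zt).
move=> i j ia jb; rewrite /= !wE //; apply: Hm => //; by rewrite -sa1 -sa2.
Qed.

(** The final a of climb lies above d.  Replace it by a member a' of A below d with the
same profile and close to d.  Then the trace from an element of a' to an element y of
bs m is the trace from d to y followed by the trace up to d; on the latter the
weights of y are those of d, and all words end with true, so this second part
contributes a number that does not depend on m. *)
Lemma oscillation_at (a0 b0 : seq W) : A a0 -> B b0 -> all_ge a0 d -> all_ge b0 d ->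
  forall n, exists a (bs : nat -> seq W), A a /\ forall m, (m <= n)%N ->
  [/\ B (bs m), size (bs m) = size (bs 0%N) &
   forall i j, (i < size a)%N -> (j < size (bs 0%N))%N ->
    nth d a i < nth d (bs m) j /\
    osc (nth d a i) (nth d (bs m) j) = (osc (nth d a i) (nth d (bs 0%N) j) + m)%N].
Proof.
move=> Aa0 Bb0 a0d b0d n; have [F [a [bs [gd H]]]] := climb Aa0 Bb0 a0d b0d n.
have [x0 x0d] := d0.
have [|g1 g1d g1P] := @coherence_bound (flatten [seq bs m | m <- iota 0 n.+1]).
  apply/allP => y /flatten_mapP[m]; rewrite mem_iota /= add0n ltnS => mn yb.
  by have [_ /allP bmd _ _ _] := H m mn; apply: bmd.
have [||g2 g2d g2P] := @unbounded_finite_sup d x0 [set` F] dlim x0d.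
- exact: finite_seq.
- by move=> x /(allP (stageF gd)).
pose g0 := Order.max g1 g2.
have g0d : g0 < d by rewrite !gt_max g1d g2d.
have [g3 g3d g3P] := trace_limit dlim g0d.
have [||u ud [a' [Aa' pa' gsa' a'u]]] := @dref [:: F; [:: g0; g3]] (3%N, (profile F a, [::])).
- by rewrite /= (stageF gd) g0d g3d.
- have [|e eP] := @countable_bounded [set` a]; first exact/finite_set_countable/finite_seq.
  exists e, a; split => //=; [exact: stageA gd| |by apply/allP => x /eP].
  move=> y z ya zg; apply: lt_le_trans (allP (stage_a gd) _ ya).
  by move: zg; rewrite !inE => /orP[] /eqP ->.
have sa' := profile_size pa'.
exists a', bs; split => // m mn; have [Bm bmd sm Fm Hm] := H m mn.
have key k i j : (k <= n)%N -> (i < size a')%N -> (j < size (bs 0%N))%N ->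
  nth d a' i < nth d (bs k) j /\
  osc (nth d a' i) (nth d (bs k) j) = (ascents true (word (nth d a i) (nth d (bs k) j)) +
    ascents true [seq (weight d z < weight (nth d a' i) z)%N | z <- trace (nth d a' i) d])%N.
  move=> kn ia jb; have [_ /allP bkd sk Fk Hk] := H k kn.
  have xa : nth d a' i \in a' by apply: mem_nth.
  have yb : nth d (bs k) j \in bs k by apply: mem_nth; rewrite sk.
  have wx z := @profile_nth F a' a d i z pa' ia; set x := nth d a' i in xa wx *.
  set y := nth d (bs k) j in yb *.
  have xd : x < d by apply: lt_trans ud; apply: (allP a'u).
  have dy : d <= y by apply: bkd.
  have g0x : g0 < x by apply: gsa' => //; rewrite !inE eqxx.
  have g3x : g3 < x by apply: gsa' => //; rewrite !inE eqxx orbT.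
  have [_ tg0] := g3P x g3x xd.
  have Fg0 z : z \in F -> z < g0 by move=> zF; rewrite lt_max (g2P z) ?orbT.
  split; first exact: lt_le_trans xd dy.
  rewrite /osc (@trace_cat x d y) ?(ltW xd) //; last 2 first.
  - by apply/allP => z /(Fk _ yb) /Fg0 zg; apply: lt_trans zg g0x.
  - by move=> z z' /(Fk _ yb) /Fg0 zg /(allP tg0); apply: lt_le_trans.
  rewrite map_cat ascents_cat.
  have -> : [seq (weight y z < weight x z)%N | z <- trace d y] = word (nth d a i) y.
    by apply/eq_in_map => z /(Fk _ yb) zF; rewrite wx.
  have [_ ->] := Hk i j (eq_ind _ (fun s => (i < s)%N) ia _ sa') jb.
  congr (_ + ascents _ _)%N; apply/eq_in_map => z zt; rewrite -(g1P z _ _ y) //.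
  - by apply: le_trans (allP tg0 _ zt); rewrite le_max lexx.
  - exact: lt_trans (trace_lt zt) xd.
  - by apply/flatten_mapP; exists k => //; rewrite mem_iota.
split => // i j ia jb; have [lt ->] := key m i j mn ia jb; split => //.
have [_ ->] := key 0%N i j (leq0n n) ia jb.
have [|-> _] := Hm i j _ jb; first by rewrite -sa'.
by rewrite addnAC.
Qed.

End Oscillation.

Theorem oscillation (A B : set (seq W)) (x0 : W) : unbounded_family A -> unbounded_family B ->
  forall n, exists a (bs : nat -> seq W), A a /\ forall m, (m <= n)%N ->
  [/\ B (bs m), size (bs m) = size (bs 0%N) &
   forall i j, (i < size a)%N -> (j < size (bs 0%N))%N ->
    nth x0 a i < nth x0 (bs m) j /\
    osc (nth x0 a i) (nth x0 (bs m) j) = (osc (nth x0 a i) (nth x0 (bs 0%N) j) + m)%N].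
Proof.
move=> Au Bu n; have [d [dlim d0 dref]] := reflection (closure_demand A B).
have [a0 Aa0 a0d] := Au d; have [b0 Bb0 b0d] := Bu d.
have [a [bs [Aa H]]] := oscillation_at dlim d0 dref Aa0 Bb0 a0d b0d n.
exists a, bs; split => // m mn; have [Bm sm Hm] := H m mn; split => // i j ia jb.
by rewrite !(set_nth_default d) ?sm //; apply: Hm.
Qed.

Lemma uncountable_fiber (P : Type) (K : countType) (S : set P) (f : P -> K) :
  ~ countable S -> exists k, ~ countable (S `&` [set p | f p = k]).
Proof.
move=> Su; apply: contrapT => nk; apply: Su.
have -> : S = \bigcup_(k in [set: K]) (S `&` [set p | f p = k]).
  by rewrite eqEsubset; split => [p Sp|p [k _ []] //]; exists (f p).
by apply: bigcup_countable => // k _; apply: contrapT => nc; apply: nk; exists k.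
Qed.

Lemma countable_setU (P : Type) (S S' : set P) :
  countable S -> countable S' -> countable (S `|` S').
Proof. by move=> cS cS'; rewrite -bigcup2E; apply: bigcup_countable => // -[|[|]]. Qed.

Lemma countable_preimage_below (P : Type) (f : P -> W) (g : W) :
  injective f -> countable [set p | f p < g].
Proof.
move=> finj; have /countable_injP[h hinj] := countable_below g.
apply/countable_injP; exists (h \o f) => p q; rewrite !inE => pg qg /hinj E.
by apply/finj/E; rewrite inE.
Qed.

Lemma uncountable_avoid (P : Type) (S S' : set P) :
  ~ countable S -> countable S' -> exists2 p, S p & ~ S' p.
Proof.
move=> Su Sc; apply: contrapT => nx; apply: Su; apply: sub_countable Sc.
by apply: subset_card_le => p Sp; apply: contrapT => nS'; apply: nx; exists p.
Qed.

(** * Moore's points and their subspaces *)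

(** A weak form of the Delta-system lemma, by induction on the sizes of the sets F p:
a point that belongs to uncountably many of them is moved into R. *)
Lemma unavoidable_root (P : Type) (S : set P) (F : P -> seq W) : ~ countable S ->
  exists (R : seq W) (S' : set P), [/\ S' `<=` S, ~ countable S' &
    forall x, x \notin R -> countable (S' `&` [set p | x \in F p])].
Proof.
move=> /(uncountable_fiber (size \o F))[k]; set S1 := S `&` _ => S1u.
have S1k p : S1 p -> (size (F p) <= k)%N by move=> [_ <-].
suff : exists (R : seq W) (S' : set P), [/\ S' `<=` S1, ~ countable S' &
    forall x, x \notin R -> countable (S' `&` [set p | x \in F p])].
  by move=> [R [S' [S'S1 ? ?]]]; exists R, S'; split => // p /S'S1[].
move: {S} S1 S1u S1k => S; elim: k F S => [|k IH] F S Su Sk.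
  exists [::], S; split => // x _; apply: sub_countable (countable0 P).
  by apply: subset_card_le => p [/Sk /=]; rewrite leqn0 size_eq0 => /eqP ->.
have [[x xu]|nx] := pselect (exists x, ~ countable (S `&` [set p | x \in F p])); last first.
  by exists [::], S; split => // x _; apply: contrapT => xu; apply: nx; exists x.
have [|R [S' [S'S S'u RP]]] := IH (fun p => [seq y <- F p | y != x]) _ xu.
  move=> p [/Sk Fk /= xF]; rewrite -ltnS; apply: leq_trans Fk.
  rewrite size_filter -(count_predC (fun y => y == x)) -addn1 addnC leq_add2r.
  by rewrite -has_count; apply/hasP; exists x.
exists (x :: R), S'; split => // [p /S'S[] //|y].
rewrite inE negb_or => /andP[yx /RP]; apply: sub_countable.
by apply: subset_card_le => p [S'p yF]; split => //=; rewrite mem_filter yx.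
Qed.

Definition interleave (x y : W) (n : nat) : bool :=
  if odd n then sval y n./2 else sval x n./2.

Lemma interleave_inj x y x' y' : interleave x y = interleave x' y' -> x = x' /\ y = y'.
Proof.
move=> E; split; apply: eq_sig_hprop; try by move=> ? ? ?; apply: Prop_irrelevance.
  by apply/funext => n; have := congr1 (@^~ n.*2) E; rewrite /interleave odd_double doubleK.
apply/funext => n; have := congr1 (@^~ n.*2.+1) E.
by rewrite /interleave /= odd_double /= uphalf_double.
Qed.

(** The real attached to (a, G a) is the interleaving of a and G a. *)
Definition moore_point (G : W -> W) (b a : W) : bool :=
  if a < b then wave (interleave a (G a)) (osc a b) else true.

(** The oscillation theorem for singletons provides x and b_0, ..., b_n with
osc x b_m = osc x b_0 + m; the wave at x takes both values along these. *)
Lemma moore_separates (G : W -> W) (S : set W) : ~ countable S ->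
  exists b b', [/\ S b, S b' & moore_point G b <> moore_point G b'].
Proof.
move=> Su; have [x0 _] := uncountable_avoid Su (countable0 _).
have /choice[n nP] a := @waves_independent 1 (fun=> interleave a (G a))
   ltac:(by move=> i j ij; rewrite ltnS leqn0 => /eqP j0; rewrite j0 in ij).
have [k Sk] := uncountable_fiber n Su; set S' := _ `&` _ in Sk.
pose A := [set [:: b] | b in S'].
have Au : unbounded_family A.
  move=> g; have [b S'b bg] := uncountable_avoid Sk (countable_below g).
  by exists [:: b]; [exists b|rewrite /= andbT leNgt; apply/negP].
have [a [bs [[x [Sx nx] aE] H]]] := oscillation x0 Au Au k.
move: H; rewrite -{}aE => H.
have [[b0 _ b0E] _ _] := H 0%N (leq0n k).
have val e : exists b, S b /\ moore_point G b x = e.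
  have [m mn /(_ 0%N isT)] := nP x (fun=> osc x b0) (fun=> e).
  rewrite nx in mn; have [[b [Sb _] bE] sb /(_ 0%N 0%N isT)] := H m mn.
  rewrite -bE -b0E => /(_ isT) /= [xb oE] E; exists b; split => //.
  by rewrite /moore_point xb oE.
have [b [Sb bt]] := val true; have [b' [Sb' bf]] := val false.
by exists b, b'; split => // E; rewrite E bf in bt.
Qed.

Lemma uncountable_moore (G : W -> W) : ~ countable (range (moore_point G)).
Proof.
move=> /countable_injP[f finj].
have [k ku] := uncountable_fiber (f \o moore_point G) uncountable_omega1.
have [b [b' [[_ /= bk] [_ /= bk'] []]]] := moore_separates G ku.
by apply: finj; rewrite ?inE; [exists b|exists b'|rewrite bk].
Qed.

(** The negated hypothesis is what two embeddings of one space yield: the coordinates of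
the second image are continuous in the topology generated by those of the first. *)
Theorem no_common_subspace (G G' : W -> W) (g0 : W) (P : Type) (u v : P -> W) :
  (forall x, g0 <= x -> G x <> G' x) -> injective u -> injective v ->
  ~ countable [set: P] ->
  ~ (forall p y, exists F : seq W, forall q,
       {in F, moore_point G (u q) =1 moore_point G (u p)} ->
       moore_point G' (v q) y = moore_point G' (v p) y).
Proof.
move=> GG' uinj vinj Pu /(fun H p => H p (v p)) /choice[F FP].
(* beyond g0, a coordinate a of F p cannot collide with v p: if a = v p then
   G a and G' (v p) differ, and so do the attached reals *)
have P0u : ~ countable [set p | g0 <= v p].
  move=> c; apply: Pu; apply: sub_countable (countable_setU c (countable_preimage_below g0 vinj)).
  by apply: subset_card_le => p _; have [|] := leP g0 (v p); [left|right].
have [R [S [S0 Su RP]]] := unavoidable_root F P0u.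
pose F' p := undup [seq x <- F p | x \notin R].
pose coord p i := nth (v p) (F' p) i.
pose label p i := if (i < size (F' p))%N then G (coord p i) else G' (v p).
have coordF p i : (i < size (F' p))%N -> coord p i \in F p.
  move=> /(mem_nth (v p)); rewrite -/(coord p i) mem_undup mem_filter.
  by move=> /andP[].
have /choice[n nP] : forall p, exists n, S p -> forall (t : nat -> nat) (e : nat -> bool),
    exists2 m, (m <= n)%N &
      forall i, (i < (size (F' p)).+1)%N ->
        wave (interleave (coord p i) (label p i)) (t i + m) = e i.
  move=> p; have [Sp|] := pselect (S p); last by exists 0%N.
  have [|n H] := @waves_independent (size (F' p)).+1 (fun i => interleave (coord p i) (label p i)).
    move=> i j ij; rewrite ltnS leq_eqVlt => /orP[/eqP jE|jF] /interleave_inj[cE].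
      rewrite /label jE ltnn -jE ij cE /coord jE nth_default // => lE.
      by apply: (GG' (v p)) lE; apply: S0.
    move=> _; have /eqP := cE; rewrite nth_uniq ?undup_uniq //; last exact: ltn_trans jF.
    by rewrite ltn_eqF.
  by exists n.
(* make the bound n p and the coordinates on the root constant *)
pose sig p := (n p, [seq moore_point G (u p) x | x <- R]).
have [[k bits] S'u] := uncountable_fiber sig Su; set S' := _ `&` _ in S'u.
have S'S p : S' p -> S p by case.
pose A := [set rcons (F' p) (v p) | p in S'].
pose B := [set [:: u p; v p] | p in S'].
have small g : countable [set p | u p < g \/ v p < g].
  exact: countable_setU (countable_preimage_below _ _) (countable_preimage_below _ _).
have Bu : unbounded_family B.
  move=> g; have [p Sp pg] := uncountable_avoid S'u (small g).
  exists [:: u p; v p]; first by exists p.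
  by rewrite /= andbT !leNgt -negb_or; apply/negP => /orP.
have Au : unbounded_family A.
  move=> g; have [|p Sp pg] := @uncountable_avoid _ S' ([set p | u p < g \/ v p < g] `|`
     \bigcup_(x in [set x | x < g /\ x \notin R]) (S `&` [set p | x \in F p])) S'u.
    apply: countable_setU (small g) _; apply: bigcup_countable => [|x [_ /RP] //].
    by apply: sub_countable (countable_below g); apply: subset_card_le => x [].
  exists (rcons (F' p) (v p)); first by exists p.
  rewrite /all_ge all_rcons; apply/andP; split.
    by rewrite leNgt; apply/negP => vg; apply: pg; left; right.
  apply/allP => x; rewrite mem_undup mem_filter => /andP[xR xF].
  rewrite leNgt; apply/negP => xg; apply: pg; right; exists x => //; split => //.
  exact: S'S.
have [p0 _] := uncountable_avoid S'u (countable0 _).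
have [a [bs [[p Sp aE] H]]] := oscillation (v p0) Au Bu k.
move: H; rewrite -{}aE size_rcons => H.
have [[q0 _ bs0E] _ _] := H 0%N (leq0n k).
pose N := size (F' p).
have nthN i : (i < N.+1)%N -> nth (v p0) (rcons (F' p) (v p)) i = coord p i.
  rewrite ltnS nth_rcons leq_eqVlt => /orP[/eqP ->|iN].
    by rewrite ltnn eqxx /coord nth_default.
  by rewrite iN; apply: set_nth_default.
pose t i := osc (coord p i) (if (i < N)%N then u q0 else v q0).
(* targets: the coordinates of p on F' p, and false at v p *)
pose e i := if (i < N)%N then moore_point G (u p) (coord p i) else false.
have [pn pR] : n p = k /\ [seq moore_point G (u p) x | x <- R] = bits.
  by case: Sp => _ /= [].
have [m mn me] := nP p (S'S _ Sp) t e; rewrite pn in mn.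
have [[q [_ [_ qR]] bsE] _ Hm] := H m mn.
have mooreq i : (i < N)%N -> moore_point G (u q) (coord p i) = moore_point G (u p) (coord p i).
  move=> iN; have iN1 : (i < N.+1)%N := ltnW iN.
  have := Hm i 0%N iN1; rewrite -bs0E -bsE nthN // => /(_ isT) /= [lt oE].
  have := me i iN1; rewrite /t /e /label iN -oE => <-.
  by rewrite /moore_point lt.
have vv : moore_point G' (v p) (v p) = true by rewrite /moore_point ltxx.
have := FP p q; rewrite vv => FPq.
have moorev : moore_point G' (v q) (v p) = false.
  have := Hm N 1%N (leqnn _); rewrite -bs0E -bsE nthN // => /(_ isT) /= [].
  rewrite /coord nth_default // => lt oE.
  have := me N (leqnn _); rewrite /t /e /label ltnn /coord nth_default // -oE.
  by rewrite /moore_point lt.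
have : {in F p, moore_point G (u q) =1 moore_point G (u p)}.
  move=> x xF; have [xR|xR] := boolP (x \in R).
    by move: qR; rewrite -pR => /eq_in_map; apply.
  have xF' : x \in F' p by rewrite mem_undup mem_filter xR.
  by have := mooreq (index x (F' p)); rewrite index_mem /coord nth_index // => ->.
by move=> /FPq; rewrite moorev.
Qed.

(** * Topology *)

Definition cube : topologicalType := prod_topology (fun _ : W => bool).

Definition moore_space (G : W -> W) : topologicalType :=
  set_type (range (moore_point G) : set cube).

(** The topology of T is the initial one for the coordinate maps of ev. *)
Definition basic_nbhs (T : topologicalType) (ev : T -> W -> bool) :=
  forall p : T, nbhs p = [set U | exists F : seq W, forall q, {in F, ev q =1 ev p} -> U q].

Lemma nbhs_cube : basic_nbhs (T := cube) id.
Proof.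
move=> p; pose agree : set_system cube :=
  [set U | exists F : seq W, forall q, {in F, q =1 p} -> U q].
have bF : Filter agree.
  split.
  - by exists [::].
  - move=> U V [F FU] [F' FV]; exists (F ++ F') => q qp.
    by split; [apply: FU|apply: FV] => x xF; apply: qp; rewrite mem_cat xF ?orbT.
  - by move=> U V UV [F FU]; exists F => q /FU /UV.
rewrite eqEsubset; split.
  have : agree --> p; last exact.
  apply/cvg_sup => x U [V [[O oO <-] Op OU]]; exists [:: x] => q qp; apply: OU.
  by rewrite /preimage /= qp ?mem_head.
move=> U [F FU]; suff : nbhs p [set q : cube | {in F, q =1 p}].
  by apply: filterS => q; exact: FU.
elim: F {FU} => [|x F IH]; first exact: filterS filterT.
have Hx : nbhs p [set q : cube | q x = p x].
  exact: (@proj_continuous W (fun=> bool) x p [set b | b = p x]).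
apply: filterS (filterI Hx IH) => q [qx qF] y; rewrite inE => /orP[/eqP -> //|].
exact: qF.
Qed.

Lemma basic_nbhs_sub (T : topologicalType) (ev : T -> W -> bool) (A : set T) :
  basic_nbhs ev -> basic_nbhs (T := set_type A) (ev \o \val).
Proof.
move=> bT p; rewrite eqEsubset; split => U.
  move=> [V [[O oO <-] Op OU]].
  have : nbhs (\val p) O by exact: open_nbhs_nbhs.
  by rewrite bT => -[F FO]; exists F => q qp; apply: OU; apply: FO.
move=> [F FU].
have Hc : nbhs (\val p) [set q | {in F, ev q =1 ev (\val p)}] by rewrite bT; exists F.
have : nbhs p ((\val : set_type A -> T) @^-1` [set q | {in F, ev q =1 ev (\val p)}]).
  exact: (@initial_continuous _ _ (set_val : set_type A -> T) p _ Hc).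
by apply: filterS => q; exact: FU.
Qed.

Lemma moore_space_nbhs G : basic_nbhs (T := moore_space G) val.
Proof. exact: basic_nbhs_sub nbhs_cube. Qed.

Lemma moore_space_unctbl (G : W -> W) : unctbl_regular_hausdorff (moore_space G).
Proof.
split.
- by rewrite (eq_countable (card_setT _)); exact: uncountable_moore.
- exact: uniform_regular.
- move=> p q pq; apply: val_inj; apply/funext => x.
  have [||r [rp rq]] := pq [set r | val r x = val p x] [set r | val r x = val q x].
  + by rewrite moore_space_nbhs; exists [:: x] => r; apply; rewrite mem_head.
  + by rewrite moore_space_nbhs; exists [:: x] => r; apply; rewrite mem_head.
  by rewrite -rp -rq.
Qed.

(** The index u p is any b whose point is the image of p. *)
Lemma embeds_moore (B : topologicalType) (G : W -> W) : embeds_in B (moore_space G) ->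
  exists u : B -> W, injective u /\ basic_nbhs (moore_point G \o u).
Proof.
move=> [A [f [g [fK gK fc gc]]]].
have /choice[u uP] : forall p, exists b, moore_point G b = \val (\val (f p)).
  by move=> p; have /set_mem[b _ bE] := valP (\val (f p)); exists b.
exists u; split.
  move=> p q upq; apply: (can_inj fK); apply: val_inj; apply: val_inj.
  by rewrite -!uP upq.
have bA := basic_nbhs_sub (A := A) (@moore_space_nbhs G).
move=> p; rewrite eqEsubset; split => U.
  rewrite -[p in nbhs p]fK => /gc; rewrite bA => -[F FU]; exists F => q qp.
  rewrite -[q]fK; apply: FU => x xF; have := qp x xF; by rewrite /= !uP.
move=> [F FU]; have : nbhs (f p) (g @^-1` U).
  rewrite bA; exists F => q qp; apply: FU => x xF; rewrite /= !uP gK; exact: qp.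
move=> gU; have : nbhs p (f @^-1` (g @^-1` U)) by exact: fc.
by apply: filterS => q; rewrite /preimage /= fK.
Qed.

Theorem moore_spaces_orthogonal (B : topologicalType) (G G' : W -> W) (g0 : W) :
  ~ countable [set: B] -> (forall x, g0 <= x -> G x <> G' x) ->
  embeds_in B (moore_space G) -> ~ embeds_in B (moore_space G').
Proof.
move=> Bu GG' /embeds_moore[u [uinj ub]] /embeds_moore[v [vinj vb]].
apply: (no_common_subspace GG' uinj vinj Bu) => p y.
have : nbhs p [set q | moore_point G' (v q) y = moore_point G' (v p) y].
  by rewrite vb; exists [:: y] => q; apply; rewrite mem_head.
by rewrite ub => -[F FU]; exists F => q /FU.
Qed.

(** * Cardinal arithmetic *)

(** Transfinite recursion in which each value is only required to be related to the set
of earlier values. *)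
Lemma greedy_recursion (U V : Type) (lt : U -> U -> Prop) (v0 : V)
    (P : set V -> V -> Prop) : well_founded lt ->
  exists f : U -> V, forall u, (exists v, P (f @` [set t | lt t u]) v) ->
    P (f @` [set t | lt t u]) (f u).
Proof.
move=> wf; pose choose_in (S : set V) :=
  if pselect (exists v, P S v) is left H then sval (cid H) else v0.
pose step u (rec : forall t, lt t u -> V) :=
  choose_in [set v | exists t (tu : lt t u), rec t tu = v].
have ext u (g h : forall t, lt t u -> V) : (forall t tu, g t tu = h t tu) -> step u g = step u h.
  move=> gh; congr choose_in; rewrite predeqE => v.
  by split => -[t [tu <-]]; exists t, tu; rewrite gh.
exists (Fix wf (fun=> V) step) => u ex; rewrite Fix_eq //.
rewrite /step /choose_in (_ : [set v | _] = (Fix wf (fun=> V) step @` [set t | lt t u])).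
  by case: pselect => // H; exact: svalP (cid H).
by rewrite predeqE => v; split => [[t [tu E]]|[t tu E]]; exists t => //; exists tu.
Qed.

Lemma well_order_exists (T : Type) : exists lt : T -> T -> Prop,
  well_founded lt /\ forall x y, x <> y -> lt x y \/ lt y x.
Proof.
elim/Peq : T => T; have [R Rwo] := well_ordering_principle T.
exists (fun x y => R x y && (x != y)); split; first exact: well_order_ind.
move=> x y /eqP xy; have /orP[xRy|yRx] := well_order_total Rwo x y.
  by left; rewrite xRy.
by right; rewrite yRx eq_sym.
Qed.

Lemma inj_in_card_le (T U : Type) (A : set T) (B : set U) (f : T -> U) :
  (forall x, A x -> B (f x)) -> (forall x y, A x -> A y -> f x = f y -> x = y) -> A #<= B.
Proof.
move=> fAB finj; rewrite -(card_le_eql (@inj_card_eq _ _ A f _)); last first.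
  by move=> x y /set_mem Ax /set_mem Ay; exact: finj.
by apply: subset_card_le => _ [x Ax <-]; exact: fAB.
Qed.

(** Along a well-order of A, choose values in B that have not been used.  Either this
never fails, which gives an injection of A into B, or it fails at some x, and then
the values taken before x exhaust B. *)
Lemma card_le_total (T U : Type) (A : set T) (B : set U) : A #<= B \/ B #<= A.
Proof.
have [[v0 Bv0]|nB] := pselect (exists v, B v); last first.
  right; rewrite (_ : B = set0); first exact: card_ge0.
  by rewrite -subset0 => v Bv; apply: nB; exists v.
have [lt [wf tot]] := well_order_exists T.
pose ltA x y := A x /\ lt x y.
have wfA : well_founded ltA.
  move=> x; elim/(well_founded_ind wf) : x => x IH; constructor => y [_]; exact: IH.
have [f fP] := greedy_recursion v0 (fun S v => B v /\ ~ S v) wfA.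
have [[x [Ax nx]]|H] := pselect (exists x, A x /\
    ~ exists v, B v /\ ~ (f @` [set t | ltA t x]) v); [right|left].
  apply: card_le_trans (card_image_le f A); apply: subset_card_le => v Bv.
  apply: contrapT => nv; apply: nx; exists v; split => // -[t [At _] tv].
  by apply: nv; exists t.
have fB x : A x -> B (f x) /\ ~ (f @` [set t | ltA t x]) (f x).
  by move=> Ax; apply: fP; apply: contrapT => ?; apply: H; exists x.
apply: (@inj_in_card_le _ _ _ _ f) => [x /fB[] //|x y Ax Ay fxy].
apply: contrapT => /tot[xy|yx].
  by have [_ []] := fB y Ay; exists x.
by have [_ []] := fB x Ax; exists y.
Qed.

(** The map f is an isomorphism of w onto the initial segment below a. *)
Definition has_rank (w : {pred nat} * rel nat) (a : W) := exists f : nat -> W,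
  [/\ forall n, n \in w.1 -> f n < a, forall b, b < a -> exists2 n, n \in w.1 & f n = b &
    {in w.1 &, forall m n, w.2 m n = (f m <= f n)}].

(** Send each n to the least ordinal that is not a value at a smaller element; it exists
because countably many values have been taken. *)
Lemma nat_wo_rank w : nat_wo w -> exists a, has_rank w a.
Proof.
case: w => D R wo.
have Rtot : {in D &, total R} := wo_chainW wo.
have Ranti : {in D &, antisymmetric R} := wo_chain_antisymmetric wo.
pose lt m n := [/\ m \in D, n \in D, R m n & m != n].
have wf : well_founded lt.
  move=> x; apply: contrapT => nx.
  have inD y : ~ Acc lt y -> y \in D.
    by move=> ny; apply: contrapT => yD; apply: ny; constructor => z [].
  have [||m [[/asboolP nm mmin] _]] := wo [pred y | `[< ~ Acc lt y >]].
  - by move=> y /asboolP; exact: inD.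
  - by exists x; apply/asboolP.
  apply: nm; constructor => y [yD mD Rym yNm]; apply: contrapT => ny.
  case/eqP: yNm; apply: Ranti => //; by rewrite Rym; apply: mmin; apply/asboolP.
pose first_gap (S : set W) a := ~ S a /\ forall b, b < a -> S b.
have gap (S : set W) : countable S -> exists a, first_gap S a.
  move=> Sc; have [b _ nSb] := uncountable_avoid uncountable_omega1 Sc.
  have [|a nSa amin] := @om_min_ex (~` S); first by exists b.
  exists a; split => // c ca; apply: contrapT => /amin; by rewrite leNgt ca.
have [x0 _] := gap _ (countable0 W).
have [f fP] := greedy_recursion x0 first_gap wf.
have {}fP n : first_gap (f @` [set m | lt m n]) (f n).
  by apply: fP; apply: gap; apply: sub_countable (card_image_le _ _) _.
have f_mono m n : lt m n -> f m < f n.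
  move=> mn; have [nfn _] := fP n; have [_ fm] := fP m; rewrite ltNge.
  apply/negP; rewrite le_eqVlt => /orP[/eqP fnm|/fm [k [kD _ Rkm kNm] fk]]; apply: nfn.
    by exists m.
  case: mn => mD nD Rmn mNn; exists k => //; split => //.
    have [||z [[zA zmin] _]] := wo [pred t | t \in [:: k; m; n]].
    - by move=> t; rewrite !inE => /or3P[] /eqP ->.
    - by exists k; rewrite !inE eqxx.
    have zk : _ -> R z k := zmin k; have zm : _ -> R z m := zmin m.
    have zn : _ -> R z n := zmin n.
    rewrite !inE !eqxx ?orbT in zk zm zn; move: zA; rewrite !inE => /or3P[] /eqP E.
    - by rewrite -{1}E zn.
    - by rewrite (Ranti k m _ _ _) // Rkm -{1}E zk.
    - by case/eqP: mNn; apply: Ranti => //; rewrite Rmn -{1}E zm.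
  by apply/eqP => kn; case/eqP: mNn; apply: Ranti => //; rewrite Rmn -kn Rkm.
have [a [nfa fa]] := gap (f @` [set` D]) (sub_countable (card_image_le _ _) (countableP _)).
exists a, f; split => [n nD|b /fa [n nD fn]|m n mD nD] /=; last 2 first.
- by exists n.
- have [<-|/eqP mn] := pselect (m = n).
    by rewrite lexx; have := Rtot m m mD mD; rewrite orbb.
  have /orP[Rmn|Rnm] := Rtot m n mD nD.
    by rewrite Rmn ltW // f_mono.
  have nm : f n < f m by apply: f_mono; split => //; rewrite eq_sym.
  rewrite leNgt nm; apply/negP => Rmn; case/eqP: mn; apply: Ranti => //.
  by rewrite Rmn Rnm.
rewrite ltNge; apply/negP; rewrite le_eqVlt => /orP[/eqP E|lt_a]; apply: nfa.
  by exists n.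
by have [_ /(_ a lt_a) [m [mD _ _ _] fm]] := fP n; exists m.
Qed.

Lemma has_rank_inj w (f : nat -> W) :
  {in w.1 &, forall m n, w.2 m n = (f m <= f n)} -> nat_wo w -> {in w.1 &, injective f}.
Proof.
move=> fm wo m n mD nD fmn; apply: (wo_chain_antisymmetric wo) => //.
by rewrite !fm // fmn lexx.
Qed.

(** Two well-ordered subsets of nat are isomorphic exactly when they have a common rank,
so that a rank determines the order type. *)
Lemma order_typeE w a : nat_wo w -> has_rank w a ->
  order_type w = [set v | nat_wo v /\ has_rank v a].
Proof.
move=> wwo [f [fa fs fR]]; have finj := has_rank_inj fR wwo.
rewrite predeqE => v; split => -[vwo].
  move=> [h hbij hR]; split => //.
  pose hi n := if pselect (exists2 m, m \in w.1 & h m = n) is left H then s2val (cid2 H) else 0.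
  have hiP n : n \in v.1 -> hi n \in w.1 /\ h (hi n) = n.
    move=> nv; rewrite /hi; case: pselect => [H|[]].
      by split; [exact: s2valP (cid2 H)|exact: s2valP' (cid2 H)].
    by have [_ _ /(_ n nv) [m mw mn]] := hbij; exists m.
  have hD m : m \in w.1 -> h m \in v.1 by case: hbij => H _ _ mw; apply: H.
  have hinj : {in w.1 &, injective h}.
    by case: hbij => _ H _ m n mw nw; apply: H; rewrite inE.
  exists (f \o hi); split => [n /hiP[nw _]|b /fs[m mw <-]|m n /hiP[mw mE] /hiP[nw nE]] /=.
  - exact: fa.
  - exists (h m); first exact: hD.
    by have [nw nE] := hiP _ (hD m mw); congr f; exact: hinj.
  - by rewrite -fR // -hR // mE nE.
move=> [g [ga gs gR]]; split => //; have ginj := has_rank_inj gR vwo.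
have /choice[h hP] : forall n, exists m, n \in w.1 -> m \in v.1 /\ g m = f n.
  move=> n; have [nw|nw] := boolP (n \in w.1); last by exists 0.
  by have [m mv mE] := gs _ (fa n nw); exists m.
exists h; last first.
  by move=> m n mw nw; have [? E] := hP m mw; have [? E'] := hP n nw; rewrite gR // E E' fR.
split.
- by move=> n /hP[].
- move=> m n /set_mem mw /set_mem nw hmn; apply: finj => //.
  by have [_ <-] := hP m mw; have [_ <-] := hP n nw; rewrite hmn.
- move=> m mv; have [n nw nE] := fs _ (ga m mv); exists n => //.
  by have [hv E] := hP n nw; apply: ginj => //; rewrite E.
Qed.

Lemma aleph1_le_omega1 : aleph1 #<= [set: W].
Proof.
apply: card_le_trans (card_image_le (fun a => [set v | nat_wo v /\ has_rank v a]) [set: W]).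
apply: subset_card_le => c [w wwo <-]; have [a wa] := nat_wo_rank wwo.
by exists a => //; rewrite (order_typeE wwo wa).
Qed.

Definition eventually_different (F : set (W -> W)) := forall G G', F G -> F G' -> G <> G' ->
  exists g, forall x, g <= x -> G x <> G' x.

(** Take a maximal family F.  If j injected F into omega_1, a function N with N x
different from G x for the countably many G in F with j G <= x would be eventually
different from every member of F, against maximality. *)
Lemma many_eventually_different :
  exists2 F, eventually_different F & ~ (F #<= [set: W]).
Proof.
have [F [FP Fmax]] : exists F, eventually_different F /\
    forall F', F `<` F' -> ~ eventually_different F'.
  apply: Zorn_bigcup => /= C CP Ctot G G' [F CF FG] [F' CF' F'G'].
  by have [FF'|F'F] := Ctot _ _ CF CF'; [apply: (CP F' CF') => //; exact: FF'|
    apply: (CP F CF) => //; exact: F'F].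
exists F => // FW; have [j jinj] : exists j : (W -> W) -> W, {in F &, injective j}.
  move: FW => /card_leP [f]; have [x0 _] := uncountable_avoid uncountable_omega1 (countable0 _).
  exists (fun G => if pselect (F G) is left FG then \val (f (exist _ G (mem_set FG))) else x0).
  move=> G G' /set_mem FG /set_mem FG'; case: pselect => // H; case: pselect => // H' /val_inj.
  by move=> fE; have [] := inj (mem_set I) (mem_set I) fE.
have /choice[N NP] : forall x, exists y, forall G, F G -> j G <= x -> G x <> y.
  move=> x; have [|y _ yP] := @uncountable_avoid _ _
      [set G x | G in F `&` [set G | j G <= x]] uncountable_omega1.
    apply: sub_countable (card_image_le _ _) _.
    have [e xe] := exists_above x; apply: sub_countable (countable_below e).
    apply: (@inj_in_card_le _ _ _ _ j) => [G [_ /= jx]|G G' [FG _] [FG' _]].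
      exact: le_lt_trans jx xe.
    by apply: jinj; exact: mem_set.
  by exists y => G FG jG GE; apply: yP; exists G.
have NF : ~ F N by move=> FN; apply: (NP (j N) N FN (lexx _)).
apply: (Fmax (F `|` [set N])); first by split => [G|H]; [left|apply: NF; apply: H; right].
have key G : F G -> exists g, forall x, g <= x -> G x <> N x.
  by move=> FG; exists (j G) => x; exact: NP.
move=> G G' [FG|->] [FG'|->] // GG'; [exact: FP|exact: key|].
by have [g gP] := key G' FG'; exists g => x /gP xN /esym.
Qed.

(** Choosing for each G in the family a member of the basis that embeds into
moore_space G is injective, by orthogonality of the spaces. *)
Theorem theorem1p13 (I : Type) (B : I -> topologicalType) :
  is_basis B -> card_lt aleph1 [set: I]%classic.
Proof.
move=> [Bu Bemb]; have [F FP Fbig] := many_eventually_different.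
suff nI : ~ ([set: I] #<= aleph1).
  by split => //; have [//|/nI] := card_le_total aleph1 [set: I].
move=> Ia; apply: Fbig.
apply: card_le_trans (card_le_trans Ia aleph1_le_omega1).
have /choice[i iP] G : exists i, embeds_in (B i) (moore_space G).
  exact: Bemb (moore_space_unctbl G).
apply: (@inj_in_card_le _ _ _ _ i) => // G G' FG FG' iG.
apply: contrapT => GG'; have [g gP] := FP G G' FG FG' GG'.
apply: (moore_spaces_orthogonal _ gP (iP G)); first by have [] := Bu (i G).
by rewrite iG; exact: iP.
Qed.
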